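(* Let $\mathfrak{C}$ be an abelian category (not necessarily with enough projective objects). Let $(\mathcal{X},\mathcal{X}^\perp)$ be a hereditary and complete cotorsion pair in $\mathfrak{C}$ and $(\mathcal{Y},\omega)$ be a Frobenius pair in $\mathfrak{C}$ such that: $\mathcal{X}^\perp$ is thick, $\mathcal{X}\subseteq\mathcal{Y}$, and $\mathcal{X}\cap\mathcal{X}^\perp=\omega$. If $(\omega^\wedge_m,[\omega^\wedge_m]^{\perp_1})$ is a complete cotorsion pair in $\mathfrak{C}$ for some $m\in\mathbb{Z}_{\geq 0}$, then for every $n\geq m$ there is a hereditary Hovey triple $$(\mathcal{X}^\wedge_m,\ \mathcal{X}^\perp\cap\mathcal{Y}^\wedge_n,\ [\omega^\wedge_m]^{\perp_1}\cap\mathcal{Y}^\wedge_n)$$ in the weakly idempotent complete exact subcategory $\mathcal{Y}^\wedge_n$. The homotopy category of its associated hereditary model structure is equivalent to the quotient category $(\mathcal{X}^\wedge_m\cap[\omega^\wedge_m]^{\perp_1})/\sim$, where for two morphisms $f,g\colon X\to Y$ with $X,Y\in\mathcal{X}^\wedge_m\cap[\omega^\wedge_m]^{\perp_1}$ one has $f\sim g$ if, and only if, $f-g$ factors through a trivially bifibrant object (that is, an object in $\omega^\wedge_m\cap[\omega^\wedge_m]^{\perp_1}$).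
   Context: $A\rightarrowtail B\twoheadrightarrow C$ denotes a short exact sequence. $\mathrm{Ext}^i_{\mathfrak C}$ is Yoneda Ext. For a class $\mathcal{X}$: $\mathcal{X}^{\perp_i}=\{N: \mathrm{Ext}^i_{\mathfrak C}(X,N)=0\ \forall X\in\mathcal X\}$ for $i>0$, $\mathcal{X}^\perp=\bigcap_{i>0}\mathcal{X}^{\perp_i}$; ${}^{\perp_1}\mathcal X$ is dual. $\mathcal{X}^\wedge_m$ is the class of objects $M$ having an exact sequence $0\to X_m\to\cdots\to X_0\to M\to 0$ with all $X_i\in\mathcal{X}$ (same notation for $\mathcal Y$, $\omega$). A class is left thick if it is closed under extensions, kernels of epimorphisms between its objects, and direct summands; thick if moreover closed under cokernels of monomorphisms between its objects. A (left) Frobenius pair $(\mathcal{Y},\omega)$: (FP1) $\mathcal{Y}$ is left thick; (FP2) $\omega$ is closed under direct summands; (FP3) $\mathrm{Ext}^i_{\mathfrak C}(Y,W)=0$ for all $Y\in\mathcal Y$, $W\in\omega$, $i>0$; (FP4) $\omega\subseteq\mathcal Y$ and every $Y\in\mathcal Y$ admits a short exact sequence $Y\rightarrowtail W\twoheadrightarrow Y'$ with $W\in\omega$, $Y'\in\mathcal Y$. A cotorsion pair $(\mathcal A,\mathcal D)$ in $\mathfrak C$: $\mathcal A^{\perp_1}=\mathcal D$ and $\mathcal A={}^{\perp_1}\mathcal D$. It is complete if every $C\in\mathfrak C$ has short exact sequences $D\rightarrowtail A\twoheadrightarrow C$ and $C\rightarrowtail D'\twoheadrightarrow A'$ with $A,A'\in\mathcal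 A$, $D,D'\in\mathcal D$; hereditary if $\mathrm{Ext}^i_{\mathfrak C}(A,D)=0$ for all $A\in\mathcal A$, $D\in\mathcal D$, $i>0$. $\mathcal Y^\wedge_n$ is left thick in $\mathfrak C$; it is regarded as a weakly idempotent complete exact category with conflations the short exact sequences of $\mathfrak C$ with all terms in $\mathcal Y^\wedge_n$. Cotorsion pairs, completeness and hereditariness in an exact category are defined in the same way, using conflations and the Ext groups of the exact category. A Hovey triple $(\mathcal Q,\mathcal W,\mathcal R)$ in an exact category $\mathcal E$: $\mathcal W$ is thick in $\mathcal E$ (closed under direct summands, and if two terms of a conflation lie in $\mathcal W$ so does the third), and $(\mathcal Q\cap\mathcal W,\mathcal R)$, $(\mathcal Q,\mathcal W\cap\mathcal R)$ are complete cotorsion pairs in $\mathcal E$; it is hereditary if both pairs are hereditary. Its associated (exact) model structure has as (trivial) cofibrations the admissible monomorphisms with cokernel in $\mathcal Q$ (resp. $\mathcal Q\cap\mathcal W$), as (trivial) fibrations the admissible epimorphisms with kernel in $\mathcal R$ (resp. $\mathcal W\cap\mathcal R$), and as weak equivalences the composites of a trivial cofibration followed by a trivial fibration. Bifibrant means in $\mathcal Q\cap\mathcal R$, trivially bifibrant means in $\mathcal Q\cap\mathcal W\cap\mathcal R$. The homotopy category is the localization at the weak equivalences. *)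

(* Defs.v *)
From HB Require Import structures.
From Stdlib Require Import Relation_Operators.
From mathcomp Require Import all_boot all_algebra generic_quotient.
From mathcomp Require Import boolp classical_sets.

Set Implicit Arguments.
Unset Strict Implicit.
Unset Printing Implicit Defensive.

Import GRing.Theory.
Local Open Scope classical_set_scope.
Local Open Scope ring_scope.
Local Obligation Tactic := idtac.

Record category := Category {
  ob :> Type;
  hom : ob -> ob -> Type;
  idm : forall A, hom A A;
  comp : forall A B C, hom B C -> hom A B -> hom A C;
  comp_idl : forall A B (f : hom A B), comp (idm B) f = f;
  comp_idr : forall A B (f : hom A B), comp f (idm A) = f;
  compA : forall A B C D (h : hom C D) (g : hom B C) (f : hom A B),
    comp h (comp g f) = comp (comp h g) f
}.
Arguments hom {_} _ _.
Arguments idm {_} _.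
Arguments comp {_ A B C} _ _.

Reserved Notation "g \c f" (at level 40, left associativity).
Notation "g \c f" := (comp g f) : ring_scope.

Definition is_iso (C : category) (A B : C) (f : hom A B) : Prop :=
  exists g : hom B A, g \c f = idm A /\ f \c g = idm B.

Record functor (C D : category) := Functor {
  fob :> C -> D;
  fmap : forall A B, hom A B -> hom (fob A) (fob B);
  fmap_id : forall A, fmap (idm A) = idm (fob A);
  fmap_comp : forall A B E (g : hom B E) (f : hom A B),
    fmap (g \c f) = fmap g \c fmap f
}.
Arguments fmap {_ _} _ {A B} _.

Program Definition idF (C : category) : functor C C :=
  @Functor C C (fun A => A) (fun A B f => f) _ _.
Next Obligation. by []. Qed.
Next Obligation. by []. Qed.

Program Definition compF (C D E : category) (G : functor D E)
    (F : functor C D) : functor C E :=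
  @Functor C E (fun A => G (F A)) (fun A B f => fmap G (fmap F f)) _ _.
Next Obligation. by move=> C D E G F A /=; rewrite !fmap_id. Qed.
Next Obligation. by move=> * /=; rewrite !fmap_comp. Qed.

Definition natural (C D : category) (F G : functor C D)
    (a : forall A, hom (F A) (G A)) : Prop :=
  forall A B (f : hom A B), fmap G f \c a A = a B \c fmap F f.

Definition nat_iso (C D : category) (F G : functor C D) : Prop :=
  exists2 a : forall A, hom (F A) (G A), natural a & forall A, is_iso (a A).

Definition equivalent (C D : category) : Prop :=
  exists (F : functor C D) (G : functor D C),
    nat_iso (compF G F) (idF C) /\ nat_iso (compF F G) (idF D).

Definition morphism_class (C : category) := forall A B : C, hom A B -> Prop.

Definition inverts (C D : category) (F : functor C D)
    (W : morphism_class C) : Prop :=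
  forall (A B : C) (f : hom A B), W A B f -> is_iso (fmap F f).

(* L : C -> H is the localization of C at W, determined up to equivalence:
   precomposition with L is, for every category D, an equivalence from the
   functors H -> D to the functors C -> D that invert W. *)
Definition is_localization (C H : category) (W : morphism_class C)
    (L : functor C H) : Prop :=
  [/\ inverts L W,
      forall (D : category) (F : functor C D), inverts F W ->
        exists G : functor H D, nat_iso (compF G L) F &
      forall (D : category) (G G' : functor H D)
        (a : forall A, hom (compF G L A) (compF G' L A)), natural a ->
        exists b : forall B, hom (G B) (G' B),
          [/\ natural b, forall A, b (L A) = a A &
            forall b' : forall B, hom (G B) (G' B), natural b' ->
              (forall A, b' (L A) = a A) -> forall B, b' B = b B]].

Record zmodCat := ZmodCat {
  zmod_cat :> category;
  hom_zmod : forall A B : zmod_cat, GRing.Zmodule (hom A B)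
}.

HB.instance Definition _ (C : zmodCat) (A B : C) :=
  GRing.Zmodule.copy (hom A B) (GRing.Zmodule.Pack (hom_zmod A B)).

Record preaddCat := PreaddCat {
  preadd_base :> zmodCat;
  comp_addl : forall (A B D : preadd_base) (g g' : hom B D) (f : hom A B),
    (g + g') \c f = g \c f + g' \c f;
  comp_addr : forall (A B D : preadd_base) (g : hom B D) (f f' : hom A B),
    g \c (f + f') = g \c f + g \c f'
}.

Section Preadditive.
Variable C : preaddCat.
Implicit Types A B K N S Z : C.

Definition is_zero_ob Z : Prop :=
  forall A, (forall f : hom A Z, f = 0) /\ (forall f : hom Z A, f = 0).

Definition is_biproduct A B S (i : hom A S) (j : hom B S)
    (p : hom S A) (q : hom S B) : Prop :=
  [/\ p \c i = idm A, q \c j = idm B, p \c j = 0, q \c i = 0 &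
      i \c p + j \c q = idm S].

Definition biproduct_of A B S : Prop :=
  exists (i : hom A S) (j : hom B S) (p : hom S A) (q : hom S B),
    is_biproduct i j p q.

Definition is_additive : Prop :=
  (exists Z, is_zero_ob Z) /\ (forall A B, exists S, biproduct_of A B S).

Definition is_kernel K A B (k : hom K A) (f : hom A B) : Prop :=
  f \c k = 0 /\
  forall T (t : hom T A), f \c t = 0 -> exists! u : hom T K, k \c u = t.

Definition is_cokernel A B N (f : hom A B) (c : hom B N) : Prop :=
  c \c f = 0 /\
  forall T (t : hom B T), t \c f = 0 -> exists! u : hom N T, u \c c = t.

Definition is_mono A B (f : hom A B) : Prop :=
  forall T (u v : hom T A), f \c u = f \c v -> u = v.

Definition is_epi A B (f : hom A B) : Prop :=
  forall T (u v : hom B T), u \c f = v \c f -> u = v.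

Definition is_abelian : Prop :=
  [/\ is_additive,
      forall A B (f : hom A B), exists K (k : hom K A), is_kernel k f,
      forall A B (f : hom A B), exists N (c : hom B N), is_cokernel f c,
      forall A B (f : hom A B), is_mono f ->
        exists N (g : hom B N), is_kernel f g &
      forall A B (f : hom A B), is_epi f ->
        exists K (g : hom K A), is_cokernel g f].

Definition is_ses A B N (i : hom A B) (p : hom B N) : Prop :=
  is_kernel i p /\ is_cokernel i p.

(* im f = ker g: f is an epimorphism onto a kernel of g *)
Definition is_exact A B N (f : hom A B) (g : hom B N) : Prop :=
  exists K (k : hom K B) (e : hom A K),
    [/\ is_kernel k g, is_epi e & f = k \c e].

Definition is_pushout A B A' B' (f : hom A B) (a : hom A A')
    (b : hom B B') (f' : hom A' B') : Prop :=
  b \c f = f' \c a /\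
  forall T (u : hom B T) (v : hom A' T), u \c f = v \c a ->
    exists! w : hom B' T, w \c b = u /\ w \c f' = v.

Definition is_pullback A B A' B' (f' : hom A' B') (a : hom A' A)
    (b : hom B' B) (f : hom A B) : Prop :=
  b \c f' = f \c a /\
  forall T (u : hom T B') (v : hom T A), b \c u = f \c v ->
    exists! w : hom T A', f' \c w = u /\ a \c w = v.

End Preadditive.

(* Preadditive categories with a distinguished class of conflations; the axioms
   of exact categories are the separate predicate is_exact_cat. *)
Record conflCat := ConflCat {
  confl_base :> preaddCat;
  conflation : forall A B C : confl_base, hom A B -> hom B C -> Prop
}.
Arguments conflation {_ A B C} _ _.

Record abelianCat := AbelianCat {
  abelian_base : preaddCat;
  abelianP : is_abelian abelian_base
}.

Definition abelian_conflCat (C : abelianCat) : conflCat :=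
  @ConflCat (abelian_base C) (@is_ses (abelian_base C)).
Coercion abelian_conflCat : abelianCat >-> conflCat.

Section ExactCategories.
Variable E : conflCat.
Implicit Types (A B K M N T : E) (X Y W omega : set E).

Definition adm_mono A B (i : hom A B) : Prop :=
  exists N (p : hom B N), conflation i p.
Definition adm_epi B N (p : hom B N) : Prop :=
  exists A (i : hom A B), conflation i p.

Definition is_exact_cat : Prop :=
  is_additive E /\
  [/\ forall A B N (i : hom A B) (p : hom B N), conflation i p -> is_ses i p,
      forall A B N A' B' N' (i : hom A B) (p : hom B N)
        (i' : hom A' B') (p' : hom B' N')
        (a : hom A A') (b : hom B B') (c : hom N N'),
        is_iso a -> is_iso b -> is_iso c ->
        b \c i = i' \c a -> c \c p = p' \c b ->
        conflation i p -> conflation i' p',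
      (forall A, adm_mono (idm A)) /\ (forall A, adm_epi (idm A)),
      (forall A B N (f : hom A B) (g : hom B N),
        adm_mono f -> adm_mono g -> adm_mono (g \c f)) /\
      (forall A B N (f : hom A B) (g : hom B N),
        adm_epi f -> adm_epi g -> adm_epi (g \c f)) &
      (forall A B A' (f : hom A B) (a : hom A A'), adm_mono f ->
        exists B' (b : hom B B') (f' : hom A' B'),
          is_pushout f a b f' /\ adm_mono f') /\
      (forall A B B' (f : hom A B) (b : hom B' B), adm_epi f ->
        exists A' (a : hom A' A) (f' : hom A' B'),
          is_pullback f' a b f /\ adm_epi f')].

Definition weakly_idempotent_complete : Prop :=
  forall A B (r : hom B A) (s : hom A B), r \c s = idm A ->
    exists K (k : hom K B), is_kernel k r.

Record ext1 (M N : E) := Ext1 {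
  ext1_mid : E;
  ext1_inc : hom N ext1_mid;
  ext1_prj : hom ext1_mid M;
  ext1_conflation : conflation ext1_inc ext1_prj
}.

(* yext k M N: the (k+1)-fold extensions N >-> E_k -> ... -> E_0 ->> M,
   presented by the conflations from which the exact sequence is spliced *)
Fixpoint yext (k : nat) (M N : E) : Type :=
  if k is k'.+1 then {K : E & (ext1 M K * yext k' K N)%type} else ext1 M N.

(* existence of a morphism of (k+1)-fold extensions with end components f, g *)
Fixpoint yext_map (k : nat) M M' N N' (f : hom M M') (g : hom N N') :
    yext k M N -> yext k M' N' -> Prop :=
  match k return yext k M N -> yext k M' N' -> Prop with
  | 0%N => fun s t => exists h : hom (ext1_mid s) (ext1_mid t),
      h \c ext1_inc s = ext1_inc t \c g /\ ext1_prj t \c h = f \c ext1_prj s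
  | k'.+1 => fun s t =>
      let: existT K (s1, s') := s in let: existT K' (t1, t') := t in
      exists (u : hom K K') (h : hom (ext1_mid s1) (ext1_mid t1)),
        [/\ h \c ext1_inc s1 = ext1_inc t1 \c u,
            ext1_prj t1 \c h = f \c ext1_prj s1 &
            yext_map u g s' t']
  end.

Definition yext_equiv (k : nat) (M N : E) : yext k M N -> yext k M N -> Prop :=
  clos_refl_sym_trans _ (@yext_map k M M N N (idm M) (idm N)).

(* Ext^i(M, N) = 0 for i > 0 (the value at i = 0 is meaningless): the underlying
   set of the group Ext^i, the classes of i-fold extensions, has one element. *)
Definition Ext_zero (i : nat) (M N : E) : Prop :=
  forall s t : yext i.-1 M N, yext_equiv s t.

Definition rperp (i : nat) X : set E :=
  [set N | forall M, X M -> Ext_zero i M N].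
Definition lperp (i : nat) X : set E :=
  [set M | forall N, X N -> Ext_zero i M N].
Definition perp X : set E := [set N | forall i, (0 < i)%N -> rperp i X N].

Definition summand_closed X : Prop :=
  forall A B S, biproduct_of A B S -> X S -> X A.

Definition ext_closed X : Prop :=
  forall A B N (i : hom A B) (p : hom B N),
    conflation i p -> X A -> X N -> X B.

Definition epi_ker_closed X : Prop :=
  forall A B N (i : hom A B) (p : hom B N),
    conflation i p -> X B -> X N -> X A.

Definition mono_coker_closed X : Prop :=
  forall A B N (i : hom A B) (p : hom B N),
    conflation i p -> X A -> X B -> X N.

Definition left_thick X : Prop :=
  [/\ ext_closed X, epi_ker_closed X & summand_closed X].

Definition thick X : Prop := left_thick X /\ mono_coker_closed X.

Definition frobenius_pair Y omega : Prop :=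
  [/\ left_thick Y,
      summand_closed omega,
      forall M V i, Y M -> omega V -> (0 < i)%N -> Ext_zero i M V &
      omega `<=` Y /\
      forall M, Y M -> exists V M' (j : hom M V) (q : hom V M'),
        [/\ conflation j q, omega V & Y M']].

Definition cotorsion_pair (P D : set E) : Prop :=
  rperp 1 P = D /\ P = lperp 1 D.

Definition complete_pair (P D : set E) : Prop :=
  forall M,
    (exists B A (i : hom B A) (p : hom A M), [/\ conflation i p, D B & P A]) /\
    (exists B A (i : hom M B) (p : hom B A), [/\ conflation i p, D B & P A]).

Definition hereditary_pair (P D : set E) : Prop :=
  forall A B i, P A -> D B -> (0 < i)%N -> Ext_zero i A B.

Definition hovey_triple (Q W R : set E) : Prop :=
  [/\ thick W,
      cotorsion_pair (Q `&` W) R /\ complete_pair (Q `&` W) R &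
      cotorsion_pair Q (W `&` R) /\ complete_pair Q (W `&` R)].

Definition hereditary_hovey_triple (Q W R : set E) : Prop :=
  [/\ hovey_triple Q W R, hereditary_pair (Q `&` W) R &
      hereditary_pair Q (W `&` R)].

Definition trivial_cofibration (Q W : set E) A B (f : hom A B) : Prop :=
  exists N (p : hom B N), conflation f p /\ (Q `&` W) N.

Definition trivial_fibration (W R : set E) A B (f : hom A B) : Prop :=
  exists K (i : hom K A), conflation i f /\ (W `&` R) K.

Definition weak_equivalence (Q W R : set E) : morphism_class E :=
  fun A B f => exists T (i : hom A T) (p : hom T B),
    [/\ trivial_cofibration Q W i, trivial_fibration W R p & f = p \c i].

(* X^hat_m: M has an exact sequence 0 -> X_m -> ... -> X_0 -> M -> 0 with terms
   in X.  The sequence is indexed by nat and vanishes above m, so exactness at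
   X_m says that X_m -> X_(m-1) (or X_0 -> M if m = 0) is a monomorphism. *)
Definition hat (X : set E) (m : nat) : set E :=
  [set M | exists (F : nat -> E) (d : forall i, hom (F i.+1) (F i))
             (e : hom (F 0%N) M),
    [/\ forall i, (i <= m)%N -> X (F i),
        forall i, (m < i)%N -> is_zero_ob (F i),
        is_epi e,
        is_exact (d 0%N) e &
        forall i, is_exact (d i.+1) (d i)]].

End ExactCategories.

Program Definition full_sub (C : category) (P : set C) : category :=
  @Category {A : C | P A} (fun A B => hom (sval A) (sval B))
    (fun A => idm (sval A)) (fun A B D g f => g \c f) _ _ _.
Next Obligation. by move=> * /=; rewrite comp_idl. Qed.
Next Obligation. by move=> * /=; rewrite comp_idr. Qed.
Next Obligation. by move=> * /=; rewrite compA. Qed.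

Program Definition full_preadd (C : preaddCat) (P : set C) : preaddCat :=
  @PreaddCat (@ZmodCat (full_sub P) (fun A B => hom_zmod (sval A) (sval B))) _ _.
Next Obligation. by move=> * /=; exact: comp_addl. Qed.
Next Obligation. by move=> * /=; exact: comp_addr. Qed.

Definition full_exact (E : conflCat) (P : set E) : conflCat :=
  @ConflCat (full_preadd P)
    (fun A B D (i : hom (sval A) (sval B)) (p : hom (sval B) (sval D)) =>
       conflation i p).

Definition restr (E : conflCat) (P X : set E) : set (full_exact P) :=
  [set A | X (sval A)].
Arguments restr {E} P X.

Section Quotient.
Local Open Scope quotient_scope.
Variables (C : preaddCat) (r : forall A B : C, hom A B -> hom A B -> Prop).

Definition is_congruence : Prop :=
  [/\ forall A B (f : hom A B), r f f,
      forall A B (f g : hom A B), r f g -> r g f,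
      forall A B (f g h : hom A B), r f g -> r g h -> r f h &
      forall A B D (f f' : hom A B) (g g' : hom B D),
        r f f' -> r g g' -> r (g \c f) (g' \c f')].

Hypothesis rP : is_congruence.

Definition cong_rel (A B : C) : rel (hom A B) := fun f g => `[< r f g >].

Lemma cong_refl A B : reflexive (@cong_rel A B).
Proof. by case: rP => rr _ _ _ f; apply/asboolP. Qed.

Lemma cong_sym A B : symmetric (@cong_rel A B).
Proof.
by case: rP => _ rs _ _ f g; apply/idP/idP => /asboolP h; apply/asboolP/rs.
Qed.

Lemma cong_trans A B : transitive (@cong_rel A B).
Proof.
case: rP => _ _ rt _ g f h /asboolP fg /asboolP gh.
by apply/asboolP; exact: rt gh.
Qed.

Canonical cong_equiv A B :=
  EquivRel (@cong_rel A B) (@cong_refl A B) (@cong_sym A B) (@cong_trans A B).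

Definition quot_hom (A B : C) := {eq_quot (cong_equiv A B)}.

Definition quot_pi (A B : C) (f : hom A B) : quot_hom A B := \pi_(quot_hom A B) f.

Definition quot_comp (A B D : C) (g : quot_hom B D) (f : quot_hom A B) :
  quot_hom A D := quot_pi (repr g \c repr f).

Lemma quot_pi_eq A B (f g : hom A B) : quot_pi f = quot_pi g <-> r f g.
Proof.
split=> [/eqmodP /asboolP //|h].
by apply/eqmodP/asboolP.
Qed.

Lemma repr_quot_pi A B (f : hom A B) : r (repr (quot_pi f)) f.
Proof. by apply/quot_pi_eq; rewrite /quot_pi reprK. Qed.

Lemma quot_comp_pi A B D (g : hom B D) (f : hom A B) :
  quot_comp (quot_pi g) (quot_pi f) = quot_pi (g \c f).
Proof.
by case: (rP) => _ _ _ rc; apply/quot_pi_eq/rc; exact: repr_quot_pi.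
Qed.

Lemma quot_piP A B (f : quot_hom A B) : exists f', f = quot_pi f'.
Proof. by exists (repr f); rewrite /quot_pi reprK. Qed.

Program Definition quotient_cat : category :=
  @Category C quot_hom (fun A => quot_pi (idm A)) quot_comp _ _ _.
Next Obligation.
by move=> A B f; case: (quot_piP f) => f' ->; rewrite quot_comp_pi comp_idl.
Qed.
Next Obligation.
by move=> A B f; case: (quot_piP f) => f' ->; rewrite quot_comp_pi comp_idr.
Qed.
Next Obligation.
move=> A B D F h g f; case: (quot_piP f) => f' ->.
case: (quot_piP g) => g' ->; case: (quot_piP h) => h' ->.
by rewrite !quot_comp_pi compA.
Qed.

End Quotient.

Definition factor_rel (C : preaddCat) (P Z : set C)
    (A B : full_preadd P) (f g : hom A B) : Prop :=
  exists (T : C) (a : hom (sval A) T) (b : hom T (sval B)),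
    Z T /\ f - g = b \c a.

(* Main.v *)
(* Put T = perp X, w_k = hat omega k and B = rperp 1 w_m. Since T is thick and (X, T)
   is complete, every vanishing statement needed reduces to Ext^1: X is closed under
   kernels of epimorphisms, Ext^1(Y, w_k) = 0, and Ext^1(hat X m, N) = 0 for N in T
   with Ext^1(w_m, N) = 0. The approximations K >-> Y0 ->> M and M >-> H ->> Y' of
   Auslander-Buchweitz (K in w_(n-1), H in w_n, Y0 and Y' in Y) show that hat Y n
   and hat X m are left thick and that hat X m meets T in w_m. The approximations
   for the pairs (X, T) and (w_m, B) then combine to those of the Hovey triple:
   a T-preenvelope followed by a B-preenvelope lands in the intersection of T and B,
   and its cokernel is an extension of an object of w_m by one of X.
   Higher Ext groups vanish because the left classes are closed under kernels of
   deflations. For the homotopy category, M <- QM -> RQM defines a functor to the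
   bifibrant objects modulo homotopy which is shown to be the localization. *)

From Stdlib Require Import Relation_Operators.
From mathcomp Require Import all_boot all_algebra.
From mathcomp Require Import boolp classical_sets.
Require Import Defs.

Set Implicit Arguments.
Unset Strict Implicit.
Unset Printing Implicit Defensive.
Import GRing.Theory.
Local Open Scope classical_set_scope.
Local Open Scope ring_scope.

(** There are no projective resolutions by which to shift dimensions, so Ext^1 is handled through
    the splitting predicate [spl] and through pullbacks and pushouts of conflations in an arbitrary
    exact category; the same lemmas then serve C, its subcategory hat Y n and, through [op_confl],
    their duals. The delicate vanishing is Ext^1(Y, w_k) = 0: induction along L >-> W ->> N meets an
    obstruction in Ext^2(M, L), and the X-cover of M, whose kernel is again in Y, brings it back to
    Ext^1. The bound m matters twice. An object of hat X m embeds in an object of w_m with cokernel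
    in X, so that orthogonality to X and to w_m controls all of hat X m; and m <= n places the
    objects of hat X m, hence the approximations by w_m, inside hat Y n. The universal property of a
    localization also concerns natural transformations; that part comes from inverting the zigzag on
    bifibrant objects, and it is what carries the equivalence over to every other localization. *)

Section Preadditive.
Variable C : preaddCat.
Implicit Types A B D K M N S T Z : C.

Lemma comp0m A B D (f : hom A B) : (0 : hom B D) \c f = 0.
Proof. by apply: (addIr (0 \c f)); rewrite -comp_addl !add0r. Qed.

Lemma compm0 A B D (g : hom B D) : g \c (0 : hom A B) = 0.
Proof. by apply: (addIr (g \c 0)); rewrite -comp_addr !add0r. Qed.

Lemma compNm A B D (g : hom B D) (f : hom A B) : (- g) \c f = - (g \c f).
Proof. by apply/eqP; rewrite -addr_eq0 -comp_addl addNr comp0m. Qed.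

Lemma compmN A B D (g : hom B D) (f : hom A B) : g \c (- f) = - (g \c f).
Proof. by apply/eqP; rewrite -addr_eq0 -comp_addr addNr compm0. Qed.

Lemma compBm A B D (g g' : hom B D) (f : hom A B) :
  (g - g') \c f = g \c f - g' \c f.
Proof. by rewrite comp_addl compNm. Qed.

Lemma compmB A B D (g : hom B D) (f f' : hom A B) :
  g \c (f - f') = g \c f - g \c f'.
Proof. by rewrite comp_addr compmN. Qed.

Lemma zero_from Z A (f g : hom Z A) : is_zero_ob Z -> f = g.
Proof. by move=> /(_ A)[_ h]; rewrite (h f) (h g). Qed.

Lemma zero_to Z A (f g : hom A Z) : is_zero_ob Z -> f = g.
Proof. by move=> /(_ A)[h _]; rewrite (h f) (h g). Qed.

Lemma id_zero Z : idm Z = 0 -> is_zero_ob Z.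
Proof.
move=> h A; split=> f; first by rewrite -(comp_idl f) h comp0m.
by rewrite -(comp_idr f) h compm0.
Qed.

Lemma kernel0 K A B (k : hom K A) (f : hom A B) : is_kernel k f -> f \c k = 0.
Proof. by case. Qed.

Lemma kernel_lift K A B (k : hom K A) (f : hom A B) T (t : hom T A) :
  is_kernel k f -> f \c t = 0 -> exists u, k \c u = t.
Proof. by case=> _ h /h [u [? _]]; exists u. Qed.

Lemma kernel_mono K A B (k : hom K A) (f : hom A B) : is_kernel k f -> is_mono k.
Proof.
case=> fk h T u v kuv.
have [|w [_ hw]] := h T (k \c u); first by rewrite compA fk comp0m.
by rewrite -(hw u erefl) (hw v).
Qed.

Lemma mono_kernel K A B (k : hom K A) (f : hom A B) : is_mono k ->
  f \c k = 0 -> (forall T (t : hom T A), f \c t = 0 -> exists u, k \c u = t) ->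
  is_kernel k f.
Proof.
move=> mk fk h; split=> // T t /h [u ut]; exists u; split=> // v vt.
by apply: mk; rewrite ut vt.
Qed.

Lemma cokernel0 A B N (f : hom A B) (c : hom B N) : is_cokernel f c -> c \c f = 0.
Proof. by case. Qed.

Lemma cokernel_ext A B N (f : hom A B) (c : hom B N) T (t : hom B T) :
  is_cokernel f c -> t \c f = 0 -> exists u, u \c c = t.
Proof. by case=> _ h /h [u [? _]]; exists u. Qed.

Lemma cokernel_epi A B N (f : hom A B) (c : hom B N) : is_cokernel f c -> is_epi c.
Proof.
case=> cf h T u v uvc.
have [|w [_ hw]] := h T (u \c c); first by rewrite -compA cf compm0.
by rewrite -(hw u erefl) (hw v).
Qed.

Lemma epi_cokernel A B N (f : hom A B) (c : hom B N) : is_epi c ->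
  c \c f = 0 -> (forall T (t : hom B T), t \c f = 0 -> exists u, u \c c = t) ->
  is_cokernel f c.
Proof.
move=> ec cf h; split=> // T t /h [u ut]; exists u; split=> // v vt.
by apply: ec; rewrite ut vt.
Qed.

Lemma iso_id A : is_iso (idm A).
Proof. by exists (idm A); rewrite comp_idl. Qed.

Lemma kernel_iso K K' A B (k : hom K A) (k' : hom K' A) (f : hom A B) :
  is_kernel k f -> is_kernel k' f -> exists2 u : hom K K', is_iso u & k' \c u = k.
Proof.
move=> hk hk'.
have [u ku] := kernel_lift hk' (kernel0 hk).
have [v kv] := kernel_lift hk (kernel0 hk').
exists u => //; exists v; split.
  by apply: (kernel_mono hk); rewrite compA kv ku comp_idr.
by apply: (kernel_mono hk'); rewrite compA ku kv comp_idr.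
Qed.

Lemma zero_iso Z Z' : is_zero_ob Z -> is_zero_ob Z' -> is_iso (0 : hom Z Z').
Proof. by move=> hZ hZ'; exists 0; split; exact: zero_from. Qed.

Lemma biproduct_iso A B S S' (i : hom A S) (j : hom B S) (p : hom S A)
    (q : hom S B) (i' : hom A S') (j' : hom B S') (p' : hom S' A) (q' : hom S' B) :
  is_biproduct i j p q -> is_biproduct i' j' p' q' ->
  exists u : hom S S',
    [/\ is_iso u, u \c i = i', u \c j = j', p' \c u = p & q' \c u = q].
Proof.
case=> pi qj pj qi e [pi' qj' pj' qi' e'].
exists (i' \c p + j' \c q); split.
- exists (i \c p' + j \c q'); split.
  + rewrite !comp_addl !comp_addr -!compA (compA p') (compA p') (compA q') (compA q').
    by rewrite pi' qj' pj' qi' !comp_idl !comp0m !compm0 addr0 add0r.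
  + rewrite !comp_addl !comp_addr -!compA (compA p) (compA p) (compA q) (compA q).
    by rewrite pi qj pj qi !comp_idl !comp0m !compm0 addr0 add0r.
- by rewrite comp_addl -!compA pi qi comp_idr compm0 addr0.
- by rewrite comp_addl -!compA pj qj comp_idr compm0 add0r.
- by rewrite comp_addr !compA pi' pj' comp_idl comp0m addr0.
- by rewrite comp_addr !compA qi' qj' comp_idl comp0m add0r.
Qed.

Lemma biproduct_sym A B S (i : hom A S) (j : hom B S) (p : hom S A)
  (q : hom S B) : is_biproduct i j p q -> is_biproduct j i q p.
Proof. by case=> *; split=> //; rewrite addrC. Qed.

Lemma biproduct_ofC A B S : biproduct_of A B S -> biproduct_of B A S.
Proof. by case=> i [j [p [q /biproduct_sym h]]]; exists j, i, q, p. Qed.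

Lemma iso_biproduct A B Z (f : hom A B) : is_iso f -> is_zero_ob Z ->
  biproduct_of A Z B.
Proof.
case=> g [gf fg] hZ; exists f, 0, g, 0.
by split; rewrite ?gf ?fg ?comp0m ?compm0 ?addr0 //; exact: zero_from.
Qed.

Lemma split_biproduct A B N (i : hom A B) (p : hom B N) (s : hom N B) :
  is_kernel i p -> p \c s = idm N -> exists r, is_biproduct i s r p.
Proof.
move=> hi ps.
have [r ir] : exists r, i \c r = idm B - s \c p.
  by apply: (kernel_lift hi); rewrite compmB compA ps comp_idl comp_idr subrr.
exists r; split=> //; last by rewrite ir subrK.
- apply: (kernel_mono hi); rewrite compA ir compBm -compA (kernel0 hi) compm0.
  by rewrite comp_idl comp_idr subr0.
- apply: (kernel_mono hi); rewrite compA ir compBm -compA ps compm0.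
  by rewrite comp_idl comp_idr subrr.
- exact: kernel0 hi.
Qed.

Lemma cosplit_biproduct A B N (i : hom A B) (p : hom B N) (r : hom B A) :
  is_cokernel i p -> r \c i = idm A -> exists s, is_biproduct i s r p.
Proof.
move=> hp ri.
have [s sp] : exists s, s \c p = idm B - i \c r.
  by apply: (cokernel_ext hp); rewrite compBm -compA ri comp_idl comp_idr subrr.
exists s; split=> //; last by rewrite sp addrC subrK.
- apply: (cokernel_epi hp); rewrite -compA sp compmB compA (cokernel0 hp) comp0m.
  by rewrite comp_idl comp_idr subr0.
- apply: (cokernel_epi hp); rewrite -compA sp compmB compA ri comp0m.
  by rewrite comp_idl comp_idr subrr.
- exact: cokernel0 hp.
Qed.

End Preadditive.

Lemma iso_square (C : category) (A B A' B' : C) (f : hom A B) (f' : hom A' B')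
    (a : hom A' A) (a' : hom A A') (b : hom B' B) (b' : hom B B') :
  b' \c b = idm B' -> a \c a' = idm A -> b \c f' = f \c a ->
  f' \c a' = b' \c f.
Proof.
move=> bb aa e; rewrite -[f' \c a']comp_idl -bb -compA (compA b) e -!compA aa.
by rewrite comp_idr.
Qed.

(** * Opposite categories and duality *)

Section Opposite.

Definition op_cat (C : category) : category :=
  @Category C (fun A B => hom B A) (fun A => idm A) (fun A B D g f => f \c g)
    (fun A B f => comp_idr f) (fun A B f => comp_idl f)
    (fun A B D F h g f => esym (compA f g h)).

Definition op_preadd (C : preaddCat) : preaddCat :=
  @PreaddCat (@ZmodCat (op_cat C) (fun A B => hom_zmod B A))
    (fun A B D g g' f => comp_addr f g g') (fun A B D g f f' => comp_addl f f' g).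

(** Kernels and cokernels are exchanged by mere conversion, so a dual statement is the original one
    at [op_confl E] with its witnesses reordered. *)
Definition op_confl (E : conflCat) : conflCat :=
  @ConflCat (op_preadd E) (fun A B D i p => @conflation E D B A p i).

Lemma op_is_iso (E : conflCat) (A B : E) (f : hom A B) :
  is_iso (f : @hom (op_confl E) B A) <-> is_iso f.
Proof. by split=> -[g [? ?]]; exists g. Qed.

Lemma op_additive (C : preaddCat) : is_additive C -> is_additive (op_preadd C).
Proof.
case=> [[Z hZ] hb]; split; first by exists Z => A; case: (hZ A).
move=> A B; have [S [i [j [p [q [? ? ? ? ?]]]]]] := hb A B.
by exists S, p, q, i, j.
Qed.

Lemma op_abelian (C : preaddCat) : is_abelian C -> is_abelian (op_preadd C).
Proof.
case=> ad hk hc hm he; split; first exact: op_additive.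
- by move=> A B f; exact: hc.
- by move=> A B f; exact: hk.
- by move=> A B f; exact: he.
- by move=> A B f; exact: hm.
Qed.

Lemma op_exact (E : conflCat) : is_exact_cat E -> is_exact_cat (op_confl E).
Proof.
case=> ad [hs hi [h1 h1'] [h2 h2'] [h3 h3']]; split; first exact: op_additive.
split.
- by move=> A B N i p /hs [].
- move=> A B N A' B' N' i p i' p' a b c /op_is_iso [a' [aa aa']].
  move=> /op_is_iso [b' [bb bb']] /op_is_iso [c' [cc cc']] e1 e2 h.
  apply: (hi _ _ _ _ _ _ _ _ _ _ c' b' a' _ _ _ _ _ h).
  + by exists c.
  + by exists b.
  + by exists a.
  + exact: esym (@iso_square E N B N' B' p p' c c' b b' bb cc' (esym e2)).
  + exact: esym (@iso_square E B A B' A' i i' b b' a a' aa bb' (esym e1)).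
- by split=> A; [exact: h1' | exact: h1].
- by split=> A B N f g hf hg; [apply: h2'|apply: h2].
- split=> A B A' f a hf.
    have [B' [b [f' [[e u] af]]]] := h3' _ _ _ f a hf.
    exists B', b, f'; split=> //; split=> [|T x y xy]; first exact: esym e.
    have [w [[w1 w2] wu]] := u T y x (esym xy).
    by exists w; split=> // v [v1 v2]; apply: wu.
  have [B' [b [f' [[e u] af]]]] := h3 _ _ _ f a hf.
  exists B', b, f'; split=> //; split=> [|T x y xy]; first exact: esym e.
  have [w [[w1 w2] wu]] := u T y x (esym xy).
  by exists w; split=> // v [v1 v2]; apply: wu.
Qed.

End Opposite.

(** * Exact categories *)

Section Conflations.
Variable E : conflCat.
Hypothesis exE : is_exact_cat E.
Implicit Types A B D K M N S T Z : E.

Lemma exact_zero : exists Z : E, is_zero_ob Z.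
Proof. by case: exE => -[]. Qed.

Lemma exact_biproduct A B : exists (S : E) (i : hom A S) (j : hom B S)
  (p : hom S A) (q : hom S B), is_biproduct i j p q.
Proof. by case: exE => -[_ /(_ A B)[S hS] _]; exists S. Qed.

Lemma confl_ses A B N (i : hom A B) (p : hom B N) : conflation i p -> is_ses i p.
Proof. by case: exE => _ [h _ _ _ _]; exact: h. Qed.

Lemma confl_kernel A B N (i : hom A B) (p : hom B N) :
  conflation i p -> is_kernel i p.
Proof. by case/confl_ses. Qed.

Lemma confl_cokernel A B N (i : hom A B) (p : hom B N) :
  conflation i p -> is_cokernel i p.
Proof. by case/confl_ses. Qed.

Lemma confl0 A B N (i : hom A B) (p : hom B N) : conflation i p -> p \c i = 0.
Proof. by move/confl_kernel/kernel0. Qed.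

Lemma confl_mono A B N (i : hom A B) (p : hom B N) : conflation i p -> is_mono i.
Proof. by move/confl_kernel/kernel_mono. Qed.

Lemma confl_epi A B N (i : hom A B) (p : hom B N) : conflation i p -> is_epi p.
Proof. by move/confl_cokernel/cokernel_epi. Qed.

Lemma confl_iso A B N A' B' N' (i : hom A B) (p : hom B N)
    (i' : hom A' B') (p' : hom B' N') (a : hom A A') (b : hom B B')
    (c : hom N N') :
  is_iso a -> is_iso b -> is_iso c -> b \c i = i' \c a -> c \c p = p' \c b ->
  conflation i p -> conflation i' p'.
Proof. by case: exE => _ [_ h _ _ _]; exact: h. Qed.

Lemma confl_of_kernel A A' B N (i : hom A B) (p : hom B N) (i' : hom A' B) :
  conflation i p -> is_kernel i' p -> conflation i' p.
Proof.
move=> h /(kernel_iso (confl_kernel h)) [u uI iu].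
by apply: (confl_iso uI (iso_id B) (iso_id N) _ _ h); rewrite comp_idl ?comp_idr.
Qed.

Lemma confl_id A Z : is_zero_ob Z -> conflation (idm A) (0 : hom A Z).
Proof.
case: exE => _ [_ _ [/(_ A)[N [p h]] _] _ _] hZ.
(* The axiom yields some cokernel of the identity; being both epi and zero, it has a zero target. *)
have p0 : p = 0 by rewrite -[p]comp_idr (confl0 h).
have hN : is_zero_ob N.
  by apply: id_zero; apply: (confl_epi h); rewrite p0 !compm0.
apply: (confl_iso (iso_id A) (iso_id A) (zero_iso hN hZ) _ _ h); first by [].
by rewrite !comp0m.
Qed.

(** The axioms give the pulled-back deflation with some kernel. The universal property shows that
    the map induced by (0, i) is a kernel too, so the left term A can be kept. *)
Lemma pb_confl A B N N' (i : hom A B) (p : hom B N) (c : hom N' N) :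
  conflation i p -> exists (B' : E) (i' : hom A B') (p' : hom B' N')
    (b : hom B' B),
    [/\ conflation i' p', b \c i' = i, p \c b = c \c p' & is_pullback p' b c p].
Proof.
move=> h; case: exE => _ [_ _ _ _ [_ h3]].
have [|B' [b [p' [[e u] [K [k hk]]]]]] := h3 _ _ _ p c; first by exists A, i.
have [|i' [[pi bi] _]] := u A 0 i; first by rewrite compm0 (confl0 h).
exists B', i', p', b; split=> //.
apply: (confl_of_kernel hk); apply: mono_kernel => // [T x y xy|T t pt].
  have ixy : i \c x = i \c y by rewrite -bi -!compA xy.
  exact: confl_mono h _ _ _ ixy.
have [|x ix] := kernel_lift (t := b \c t) (confl_kernel h).
  by rewrite compA -e -compA pt compm0.
have [|w [_ wu]] := u T (p' \c t) (b \c t); first by rewrite !compA e.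
exists x; rewrite -(wu t) //; apply/esym/wu.
by rewrite !compA pi bi comp0m pt ix.
Qed.

(** The kernel of [q \c p] is the pullback of [p] along [j], hence an extension of the kernel of [q]
    by the kernel of [p]. *)
Lemma comp_epi K A B M N (i : hom K A) (p : hom A B) (j : hom M B) (q : hom B N) :
  conflation i p -> conflation j q ->
  exists (P : E) (k : hom P A) (i' : hom K P) (p' : hom P M),
    [/\ conflation k (q \c p), conflation i' p', k \c i' = i & p \c k = j \c p'].
Proof.
move=> h1 h2; have [P [i' [p' [k [hc ki pk [_ u]]]]]] := pb_confl j h1.
exists P, k, i', p'; split=> //.
have [L [l hl]] : adm_epi (q \c p).
  case: exE => _ [_ _ _ [_ h] _]; apply: h; first by exists K, i.
  by exists M, j.
apply: (confl_of_kernel hl); apply: mono_kernel => [T x y xy||T t].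
- have pxy : p' \c x = p' \c y.
    by apply: (confl_mono h2); rewrite !compA -pk -!compA xy.
  have [|w [_ wu]] := u T (p' \c x) (k \c x); first by rewrite !compA pk.
  by rewrite -(wu x) // (wu y).
- by rewrite -compA pk compA (confl0 h2) comp0m.
rewrite -compA => qt; have [v jv] := kernel_lift (confl_kernel h2) qt.
by have [w [[_ kw] _]] := u T v t jv; exists w.
Qed.

(** Pulling A = A ->> 0 back along B -> 0 gives a split conflation, and biproducts are unique up to
    isomorphism. *)
Lemma biproduct_confl A B S (i : hom A S) (j : hom B S) (p : hom S A)
  (q : hom S B) : is_biproduct i j p q -> conflation i q.
Proof.
move=> h; have [Z hZ] := exact_zero.
have [P [i' [p' [a [hc ai _ _]]]]] := pb_confl (0 : hom B Z) (confl_id A hZ).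
have [s hs] := cosplit_biproduct (confl_cokernel hc) ai.
have [u [uI ui _ _ qu]] := biproduct_iso hs h.
apply: (confl_iso (iso_id A) uI (iso_id B) _ _ hc); first by rewrite ui comp_idr.
by rewrite comp_idl qu.
Qed.

End Conflations.

(** * Pushouts and composites of inflations, by duality *)

Section DualConflations.
Variable E : conflCat.
Hypothesis exE : is_exact_cat E.
Implicit Types A B D K M N S T Z : E.

Lemma confl_id0 A Z : is_zero_ob Z -> conflation (0 : hom Z A) (idm A).
Proof.
by move=> hZ; apply: (@confl_id _ (op_exact exE) A Z) => B; have [] := hZ B.
Qed.

Lemma po_confl A B N A' (i : hom A B) (p : hom B N) (a : hom A A') :
  conflation i p -> exists (B' : E) (i' : hom A' B') (p' : hom B' N)
    (b : hom B B'),
    [/\ conflation i' p', p' \c b = p, b \c i = i' \c a & is_pushout i a b i'].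
Proof.
move=> h.
have [B' [p' [i' [b [h1 h2 h3 [h4 h5]]]]]] :=
  @pb_confl _ (op_exact exE) N B A A' p i a h.
exists B', i', p', b; split=> //; split=> [|T u v uv]; first exact: h3.
have [w [[w1 w2] wu]] := h5 T v u (esym uv).
by exists w; split=> // x [x1 x2]; apply: wu.
Qed.

Lemma comp_mono A B D N L (i : hom A B) (p : hom B N) (j : hom B D) (q : hom D L) :
  conflation i p -> conflation j q ->
  exists (P : E) (k : hom D P) (j' : hom N P) (q' : hom P L),
    [/\ conflation (j \c i) k, conflation j' q', q' \c k = q & k \c j = j' \c p].
Proof.
move=> h1 h2.
have [P [k [i' [p' [h3 h4 h5 h6]]]]] :=
  @comp_epi _ (op_exact exE) L D B N A q j p i h2 h1.
by exists P, k, p', i'.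
Qed.

End DualConflations.

(** * Vanishing of Ext^1 as splitting of extensions *)

Section Splitting.
Variable E : conflCat.
Hypothesis exE : is_exact_cat E.
Implicit Types A B D K M N S T Z : E.

(* Ext^1(M, N) = 0: see Ext_zero1. *)
Definition spl M N : Prop := forall T (i : hom N T) (p : hom T M),
  conflation i p -> exists s, p \c s = idm M.

Lemma spl_retraction M N T (i : hom N T) (p : hom T M) : spl M N ->
  conflation i p -> exists r, r \c i = idm N.
Proof.
move=> h c; have [s ps] := h _ _ _ c.
by have [r []] := split_biproduct (confl_kernel exE c) ps; exists r.
Qed.

Lemma retraction_section M N T (i : hom N T) (p : hom T M) r :
  conflation i p -> r \c i = idm N -> exists s, p \c s = idm M.
Proof.
move=> c ri.
by have [s []] := cosplit_biproduct (confl_cokernel exE c) ri; exists s.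
Qed.

(** Splitting is invariant under morphisms of extensions with identity ends: a section moves
    forward, a retraction moves backward. Hence whatever is connected to the biproduct extension
    splits. Conversely, a retraction of one split extension and a section of another add up to a
    morphism between them. *)
Lemma Ext_zero1 M N : Ext_zero 1 M N <-> spl M N.
Proof.
split=> [h T i p c | h s t].
  have [Z hZ] := exact_zero exE.
  have [S [j [k [q [r hb]]]]] := exact_biproduct exE N M.
  pose has_section (s : ext1 M N) := exists x, ext1_prj s \c x = idm M.
  have sec_map (s t : ext1 M N) : @yext_map E 0 _ _ _ _ (idm M) (idm N) s t ->
    has_section s <-> has_section t.
    case=> u; rewrite comp_idl comp_idr => -[ui pu]; split=> -[x hx].
      by exists (u \c x); rewrite compA pu.
    have [y [yi _ _ _ _]] := split_biproduct (confl_kernel exE (ext1_conflation t)) hx.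
    apply: (retraction_section (ext1_conflation s) (r := y \c u)).
    by rewrite -compA ui.
  have sec_equiv s t : @yext_equiv E 0 M N s t -> has_section s <-> has_section t.
    elim=> {s t} [s t /sec_map //|s|s t _ [h1 h2]|s t u _ [h1 h2] _ [h3 h4]].
    - by split.
    - by split.
    - by split; auto.
  have /sec_equiv [h1 _] := h (Ext1 (biproduct_confl exE hb)) (Ext1 c).
  by apply: h1; exists k => /=; case: hb.
apply: rst_step.
have [r ri] := spl_retraction h (ext1_conflation s).
have [x hx] := h _ _ _ (ext1_conflation t).
exists (ext1_inc t \c r + x \c ext1_prj s).
rewrite comp_addl comp_addr -!compA ri (confl0 exE (ext1_conflation s)).
rewrite !compA (confl0 exE (ext1_conflation t)) hx compm0 comp0m addr0 add0r.
by rewrite comp_idr.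
Qed.

(** The obstruction to lifting [f] is the pullback of the conflation along [f], an extension of M by
    K. *)
Lemma spl_lift M K A B (i : hom K A) (p : hom A B) (f : hom M B) :
  spl M K -> conflation i p -> exists g, p \c g = f.
Proof.
move=> h c; have [B' [i' [p' [b [c' bi pb _]]]]] := pb_confl exE f c.
have [s ps] := h _ _ _ c'.
by exists (b \c s); rewrite compA pb -compA ps comp_idr.
Qed.

Lemma spl_extend A B M N (i : hom A B) (p : hom B M) (f : hom A N) :
  spl M N -> conflation i p -> exists g, g \c i = f.
Proof.
move=> h c; have [B' [i' [p' [b [c' pb bi _]]]]] := po_confl exE f c.
have [r ri] := spl_retraction h c'.
by exists (r \c b); rewrite -compA bi compA ri comp_idl.
Qed.

(** In an extension T of B by N, the preimage P of A retracts onto N; since T/P = D, the retraction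
    extends to T. *)
Lemma spl_extl A B D N (i : hom A B) (p : hom B D) :
  conflation i p -> spl A N -> spl D N -> spl B N.
Proof.
move=> c hA hD T j q c'.
have [P [k [j' [q' [c1 c2 kj _]]]]] := comp_epi exE c' c.
have [r rj] := spl_retraction hA c2.
have [g gk] := spl_extend r hD c1.
by apply: (retraction_section c' (r := g)); rewrite -kj compA gk.
Qed.

Lemma spl_extr A B D M (i : hom A B) (p : hom B D) :
  conflation i p -> spl M A -> spl M D -> spl M B.
Proof.
move=> c hA hD T j q c'.
have [P [k [j' [q' [c1 c2 qk _]]]]] := comp_mono exE c c'.
have [s ps] := hD _ _ _ c2.
have [g kg] := spl_lift s hA c1.
by exists g; rewrite -qk -compA kg.
Qed.

Lemma spl_summandl A B S N : biproduct_of A B S -> spl S N -> spl A N.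
Proof.
case=> i [j [p [q [pi _ _ _ _]]]] h T k r c.
have [g rg] := spl_lift p h c.
by exists (g \c i); rewrite compA rg.
Qed.

Lemma section_summand (P : set E) A K M (i : hom K A) (p : hom A M) (s : hom M A) :
  summand_closed P -> conflation i p -> p \c s = idm M -> P A -> P M.
Proof.
move=> hP c ps; have [r h] := split_biproduct (confl_kernel exE c) ps.
by apply: hP; exists s, i, p, r; exact: biproduct_sym h.
Qed.

Lemma iso_closed (P : set E) A B (f : hom A B) :
  summand_closed P -> is_iso f -> P A -> P B.
Proof.
move=> hP [g [gf fg]] PA; have [Z hZ] := exact_zero exE.
apply: (hP B Z A) PA; apply: (iso_biproduct (f := g)) => //.
by exists f.
Qed.

Lemma zero_closed (P : set E) A Z : summand_closed P -> is_zero_ob Z -> P A -> P Z.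
Proof.
move=> hP hZ; apply: (hP Z A A); apply: biproduct_ofC.
exact: (iso_biproduct (iso_id A)).
Qed.

Lemma zero_spll Z N : is_zero_ob Z -> spl Z N.
Proof. by move=> hZ T i p c; exists 0; exact: zero_from. Qed.

Lemma zero_splr Z M : is_zero_ob Z -> spl M Z.
Proof.
move=> hZ T i p c; apply: (retraction_section c (r := 0)); exact: zero_from.
Qed.

End Splitting.

(** * Abelian categories and extension-closed subcategories *)

Section AbelianExact.

Lemma mono_ses (C : preaddCat) (abC : is_abelian C) (A B : C) (f : hom A B) :
  is_mono f -> exists (N : C) (c : hom B N), is_ses f c.
Proof.
case: abC => _ _ hc hm _ mf.
have [N [c cf]] := hc _ _ f; have [L [g fg]] := hm _ _ _ mf.
exists N, c; split=> //; apply: mono_kernel => //; first exact: cokernel0 cf.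
move=> T t ct; have [u ug] := cokernel_ext cf (kernel0 fg).
by apply: (kernel_lift fg); rewrite -ug -compA ct compm0.
Qed.

Lemma epi_ses (C : preaddCat) (abC : is_abelian C) (B N : C) (f : hom B N) :
  is_epi f -> exists (K : C) (k : hom K B), is_ses k f.
Proof.
by move=> /(@mono_ses _ (op_abelian abC) N B f) [K [k [? ?]]]; exists K, k.
Qed.

(** The pushout is the cokernel of the monomorphism (f, -a) from A to the biproduct of B and A'.
    That map is also the kernel of its cokernel, which gives the injectivity of A' -> B'. *)
Lemma pushout_mono (C : preaddCat) (abC : is_abelian C) (A B A' : C)
    (f : hom A B) (a : hom A A') : is_mono f ->
  exists (B' : C) (b : hom B B') (f' : hom A' B'), is_pushout f a b f' /\ is_mono f'.
Proof.
move=> mf; have [[_ hb] _ hc _ _] := abC.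
have [S [i [j [p [q [pi qj pj qi e]]]]]] := hb B A'.
have pf : p \c (i \c f - j \c a) = f.
  by rewrite compmB !compA pi pj comp0m subr0 comp_idl.
have mphi : is_mono (i \c f - j \c a).
  by move=> T u v uv; apply: mf; rewrite -pf -!compA uv.
have [N [c [hk hcok]]] := mono_ses abC mphi.
exists N, (c \c i), (c \c j); split; last first.
  move=> T u v uv; apply/eqP; rewrite -subr_eq0; apply/eqP.
  have [|w hw] := kernel_lift (t := j \c (u - v)) hk.
    by rewrite compA compmB uv subrr.
  have w0 : w = 0.
    by apply: mf; rewrite -{1}pf -compA hw compA pj comp0m compm0.
  by rewrite -[u - v]comp_idl -qj -compA -hw w0 !compm0.
split=> [|T u v uv].
  by apply/eqP; rewrite -subr_eq0 -!compA -compmB (cokernel0 hcok).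
have [|w hw] := cokernel_ext (t := u \c p + v \c q) hcok.
  rewrite compmB !comp_addl -!compA (compA p) (compA q) (compA p) (compA q).
  by rewrite pi qj pj qi !comp_idl !comp0m !compm0 addr0 add0r uv subrr.
exists w; split.
  rewrite !compA hw !comp_addl -!compA pi pj qi qj.
  by rewrite !comp_idr !compm0 addr0 add0r.
move=> x [xu xv]; apply: (cokernel_epi hcok); rewrite hw -[x \c c]comp_idr -e.
by rewrite comp_addr !compA -(compA x) xu -(compA x) xv.
Qed.

Lemma abelian_exact (C : abelianCat) : is_exact_cat C.
Proof.
have abC := abelianP C.
have adm_monoP (A B : C) (f : hom A B) : adm_mono f <-> is_mono f.
  split=> [[N [p [/kernel_mono]]] // | /(mono_ses abC) [N [c h]]].
  by exists N, c.
have adm_epiP (A B : C) (f : hom A B) : adm_epi f <-> is_epi f.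
  split=> [[N [p [_ /cokernel_epi]]] // | /(epi_ses abC) [N [c h]]].
  by exists N, c.
split; first by case: abC.
split=> //.
- move=> A B N A' B' N' i p i' p' a b c [a' [aa aa']] [b' [bb bb']] [c' [cc cc']].
  move=> e1 e2 [hk hc].
  have mi' : is_mono i'.
    move=> T u v uv; rewrite -(comp_idl u) -(comp_idl v) -aa' -!compA.
    congr (_ \c _); apply: (kernel_mono hk); rewrite -[i]comp_idl -bb -(compA b') e1.
    by rewrite -!compA (compA a) (compA a) aa' !comp_idl uv.
  have ep' : is_epi p'.
    move=> T u v uv; rewrite -(comp_idr u) -(comp_idr v) -cc' !compA.
    congr (_ \c _); apply: (cokernel_epi hc); rewrite -!compA e2.
    by rewrite !compA uv.
  have pi' : p' \c i' = 0.
    rewrite -[i']comp_idr -aa' (compA i') -e1 !compA -e2 -(compA c) (kernel0 hk).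
    by rewrite compm0 comp0m.
  split.
    apply: mono_kernel => // T t pt.
    have [|u hu] := kernel_lift (t := b' \c t) hk.
      rewrite -[p]comp_idl -cc -(compA c') e2 -!compA (compA b) bb' comp_idl pt.
      by rewrite compm0.
    by exists (a \c u); rewrite compA -e1 -compA hu compA bb' comp_idl.
  apply: epi_cokernel => // T t ti.
  have [|u hu] := cokernel_ext (t := t \c b) hc.
    by rewrite -compA e1 compA ti comp0m.
  exists (u \c c'); rewrite -[t]comp_idr -bb' (compA t) -hu -!compA.
  congr (_ \c _); rewrite -[c' \c p']comp_idr -bb' -!compA (compA p') -e2.
  by rewrite -!compA (compA c') cc comp_idl.
- by split=> A; [apply/adm_monoP | apply/adm_epiP] => T u v; rewrite ?comp_idl ?comp_idr.
- split=> A B N f g; [rewrite !adm_monoP|rewrite !adm_epiP] => mf mg T u v.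
    by rewrite -!compA => /mg /mf.
  by rewrite !compA => /mf /mg.
split=> A B A' f a.
  rewrite adm_monoP => /(pushout_mono abC a) [B' [b [f' [po mf']]]].
  by exists B', b, f'; rewrite adm_monoP.
rewrite adm_epiP => ef.
have [B' [b [f' [[e u] mf']]]] := @pushout_mono _ (op_abelian abC) B A A' f a ef.
exists B', b, f'; rewrite adm_epiP; split=> //; split=> [|T x y xy]; first exact: esym e.
have [w [[w1 w2] wu]] := u T y x (esym xy).
by exists w; split=> // v [v1 v2]; apply: wu.
Qed.

End AbelianExact.

Section ExtensionClosed.
Variables (E : conflCat) (P : set E).
Hypotheses (exE : is_exact_cat E) (extP : ext_closed P).
Hypothesis zeroP : exists2 Z, is_zero_ob Z & P Z.
Implicit Types A B N : full_exact P.

Lemma full_is_iso A B (f : hom A B) :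
  is_iso f <-> is_iso (f : hom (sval A) (sval B)).
Proof. by split=> -[g [? ?]]; exists g. Qed.

(** Every object that the axioms ask for (biproducts, pushouts, pullbacks, kernels and cokernels of
    composites) is the middle term of a conflation whose ends lie in P. *)
Lemma full_exact_is_exact : is_exact_cat (full_exact P).
Proof.
have [Z hZ PZ] := zeroP.
have [_ [_ _ [h1 h1'] _ _]] := exE.
split.
  split; first by exists (exist _ Z PZ) => A; have [] := hZ (sval A).
  move=> [A PA] [B PB]; have [S [i [j [p [q hb]]]]] := exact_biproduct exE A B.
  have PS : P S := extP (biproduct_confl exE hb) PA PB.
  by exists (exist _ S PS), i, j, p, q; case: hb.
split.
- move=> A B N i p /(confl_ses exE) [[pi hi] [ip hp]]; split; split=> //.
    by move=> T t; exact: hi.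
  by move=> T t; exact: hp.
- move=> A B N A' B' N' i p i' p' a b c /full_is_iso ha /full_is_iso hb.
  move=> /full_is_iso hc e1 e2 h.
  exact: (@confl_iso E exE (sval A) (sval B) (sval N) (sval A') (sval B')
    (sval N') i p i' p' a b c ha hb hc e1 e2 h).
- split=> -[A PA].
    by exists (exist _ Z PZ), (0 : hom A Z); exact: (@confl_id E exE A Z hZ).
  by exists (exist _ Z PZ), (0 : hom Z A); exact: (@confl_id0 E exE A Z hZ).
- split=> A B D f g.
    move=> [N [p h]] [L [q h']].
    have [M [k [j' [q' [c1 c2 _ _]]]]] := comp_mono exE h h'.
    by exists (exist _ M (extP c2 (svalP N) (svalP L))), k.
  move=> [N [p h]] [L [q h']].
  have [M [k [j' [q' [c1 c2 _ _]]]]] := comp_epi exE h h'.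
  by exists (exist _ M (extP c2 (svalP N) (svalP L))), k.
split=> A B A' f a [N [p h]].
  have [B' [i' [p' [b [h' _ _ [e u]]]]]] :=
    po_confl exE (a : hom (sval A) (sval A')) h.
  exists (exist _ B' (extP h' (svalP A') (svalP N))), b, i'; split.
    by split=> // T; exact: u.
  by exists N, p'.
have [B' [i' [p' [b [h' _ _ [e u]]]]]] :=
  pb_confl exE (a : hom (sval A') (sval B)) h.
exists (exist _ B' (extP h' (svalP N) (svalP A'))), b, p'; split.
  by split=> // T; exact: u.
by exists N, i'.
Qed.

End ExtensionClosed.

(** * Finite resolutions *)

Section DoublePullback.
Variable E : conflCat.
Hypothesis exE : is_exact_cat E.
Implicit Types A B D K M N S T Z : E.

(** [pb_confl] keeps the kernel of one side only. It is applied once to each side, and the two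
    pullbacks are identified so that both conflations share the object P. *)
Lemma pb_confl2 A B N M D (i : hom A B) (p : hom B N) (j : hom M D) (q : hom D N) :
  conflation i p -> conflation j q ->
  exists (P : E) (i' : hom A P) (p' : hom P D) (j' : hom M P) (q' : hom P B),
    [/\ conflation i' p', conflation j' q', q' \c i' = i, p' \c j' = j &
        p \c q' = q \c p'].
Proof.
move=> h1 h2.
have [P [i' [p' [b [c1 bi e1 [_ u1]]]]]] := pb_confl exE q h1.
have [P' [j' [q' [b' [c2 bj e2 [_ u2]]]]]] := pb_confl exE p h2.
have [u [[pu bu] _]] := u1 _ b' q' e2.
have [v [[qv bv] _]] := u2 _ b p' e1.
exists P, i', p', (u \c j'), b; split=> //; last by rewrite compA pu bj.
have uv : u \c v = idm P.
  have [w [_ wu]] := u1 _ p' b (esym e1).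
  rewrite -(wu (idm P)) ?comp_idr //; apply/esym/wu.
  by rewrite !compA pu bu bv qv.
have vu : v \c u = idm P'.
  have [w [_ wu]] := u2 _ q' b' (esym e2).
  rewrite -(wu (idm P')) ?comp_idr //; apply/esym/wu.
  by rewrite !compA qv bv bu pu.
have uI : is_iso u by exists v.
apply: (confl_iso exE (iso_id M) uI (iso_id B) _ _ c2).
  by rewrite comp_idr.
by rewrite comp_idl.
Qed.

End DoublePullback.

Lemma po_confl2 (E : conflCat) (exE : is_exact_cat E) (A B N D M : E)
    (i : hom A B) (p : hom B N) (j : hom A D) (q : hom D M) :
  conflation i p -> conflation j q ->
  exists (P : E) (i' : hom D P) (p' : hom P N) (j' : hom B P) (q' : hom P M),
    [/\ conflation i' p', conflation j' q', p' \c j' = p, q' \c i' = q &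
        j' \c i = i' \c j].
Proof.
move=> h1 h2.
have [P [i' [p' [j' [q' [c1 c2 e1 e2 e3]]]]]] :=
  @pb_confl2 _ (op_exact exE) N B A M D p i q j h1 h2.
by exists P, p', i', q', j'.
Qed.

Section Resolutions.

(** The recursive form of [hat]: one conflation whose kernel has a shorter resolution. It suits
    induction and makes sense for any class of conflations. *)
Fixpoint rhat (E : conflCat) (X : set E) (n : nat) : set E :=
  if n is k.+1 then
    [set M | exists (K A : E) (i : hom K A) (p : hom A M),
      [/\ conflation i p, X A & rhat X k K]]
  else X.

Variable E : conflCat.
Hypothesis exE : is_exact_cat E.
Implicit Types X : set E.

Lemma rhat_subset X X' k : X `<=` X' -> rhat X k `<=` rhat X' k.
Proof.
move=> h; elim: k => [//|k IH] M [K [A [i [p [c XA hK]]]]].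
by exists K, A, i, p; split; auto.
Qed.

Lemma rhat_leS X Z k : is_zero_ob Z -> X Z -> rhat X k `<=` rhat X k.+1.
Proof.
move=> hZ XZ; elim: k => [|k IH] M.
  by exists Z, M, 0, (idm M); split=> //; exact: confl_id0.
move=> [K [A [i [p [c XA hK]]]]]; exists K, A, i, p; split=> //; exact: IH.
Qed.

Lemma rhat_le X Z k l : is_zero_ob Z -> X Z -> (k <= l)%N -> rhat X k `<=` rhat X l.
Proof.
move=> hZ XZ /subnK <-; elim: (l - k)%N => [//|d IH] M /IH.
exact: rhat_leS hZ XZ _.
Qed.

Lemma rhat_mono_coker X k : mono_coker_closed X -> rhat X k `<=` X.
Proof.
move=> h; elim: k => [//|k IH] M [K [A [i [p [c XA /IH hK]]]]].
exact: h c hK XA.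
Qed.

End Resolutions.

(** * Resolutions in abelian categories *)

Section AbelianResolutions.
Variable C : abelianCat.
Let exC := abelian_exact C.
Implicit Types A B D K M N S T Z : C.

Lemma kernel_epi_confl K A B (k : hom K A) (f : hom A B) :
  is_kernel k f -> is_epi f -> conflation k f.
Proof.
move=> hk /(epi_ses (abelianP C)) [L [l c]].
exact: (@confl_of_kernel C exC L K A B l f k c hk).
Qed.

Lemma kernel_compl K A B D (k : hom K A) (f : hom A B) (m : hom B D) :
  is_mono m -> is_kernel k (m \c f) <-> is_kernel k f.
Proof.
move=> mm; split=> -[fk h]; split=> [|T t ft].
- by apply: mm; rewrite compA fk compm0.
- by apply: h; rewrite -compA ft compm0.
- by rewrite -compA fk compm0.
- by apply: h; apply: mm; rewrite compA ft compm0.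
Qed.

Lemma is_exact_compl A B D F (f : hom A B) (g : hom B D) (m : hom D F) :
  is_mono m -> is_exact f (m \c g) <-> is_exact f g.
Proof.
move=> mm; split=> -[K [k [e [/(kernel_compl _ _ mm) hk ee fe]]]];
  by exists K, k, e.
Qed.

(** For m = 0 the augmentation has zero kernel, so it is an isomorphism and closure under summands
    transports membership. Otherwise [d 0] is an epi [x] followed by the kernel of the augmentation;
    the shifted complex augmented by [x] resolves that kernel, exactness being unaffected by a
    monomorphism on the left. *)
Lemma hatE (X : set C) m : summand_closed X -> (exists A, X A) ->
  hat X m = rhat X m.
Proof.
move=> sX [A0 XA0]; have [Z hZ] := exact_zero exC.
have XZ := zero_closed sX hZ XA0.
apply/seteqP; split; elim: m => [|m IH] M.
- move=> [F [d [e [hX hF ee hd _]]]].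
  have eM : is_iso e; last by apply: (iso_closed exC sX eM); exact: hX.
  have [K [k [x [hk ex dx]]]] := hd.
  have k0 : k = 0.
    by apply: ex; rewrite -dx; apply: zero_from; exact: hF.
  have hc := confl_cokernel exC (kernel_epi_confl hk ee).
  have [|s se] := cokernel_ext (t := idm (F 0%N)) hc; first by rewrite k0 compm0.
  by exists s; split=> //; apply: ee; rewrite -compA se comp_idl comp_idr.
- move=> [F [d [e [hX hF ee hd hdd]]]].
  have [K [k [x [hk ex dx]]]] := hd.
  exists K, (F 0%N), k, e; split; [exact: kernel_epi_confl|exact: hX|].
  apply: IH; exists (fun i => F i.+1), (fun i => d i.+1), x; split=> //.
  + by move=> i im; apply: hX.
  + by move=> i im; apply: hF.
  + by have := hdd 0%N; rewrite dx is_exact_compl //; exact: kernel_mono hk.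
- move=> XM; pose F i := if i is _.+1 then Z else M.
  pose d i : hom (F i.+1) (F i) := 0.
  exists F, d, (idm M); split.
  + by case.
  + by case.
  + by move=> T u v; rewrite !comp_idr.
  + exists Z, 0, (idm Z); split; last by rewrite comp0m.
      apply: mono_kernel; [by move=> *; exact: zero_to|by rewrite compm0|].
      by move=> T t; rewrite comp_idl => ->; exists 0; rewrite comp0m.
    by move=> T u v; rewrite !comp_idr.
  + move=> i; exists Z, (idm Z), (idm Z); split.
    * split; first by rewrite comp0m.
      by move=> T t _; exists t; split=> [|u <-]; rewrite comp_idl.
    * by move=> T u v; rewrite !comp_idr.
    * exact: zero_from.
- move=> [K [A [k [e [c XA /IH [F [d [x [hX hF ex hd hdd]]]]]]]]].
  pose F' i := if i is j.+1 then F j else A.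
  pose d' i : hom (F' i.+1) (F' i) := if i is j.+1 then d j else k \c x.
  have hk := confl_kernel exC c.
  exists F', d', e; split.
  + by case=> [|i] //; exact: hX.
  + by case=> [|i] //; exact: hF.
  + have ee := confl_epi exC c; exact: ee.
  + by exists K, k, x.
  + case=> [|i]; last exact: hdd.
    by apply/is_exact_compl => //; exact: kernel_mono hk.
Qed.

(** The biproduct on the right is prescribed, so that a given decomposition of an object can be
    resolved; the other two are chosen. *)
Lemma sum_confl K1 A1 B1 K2 A2 B2 (i1 : hom K1 A1) (p1 : hom A1 B1)
    (i2 : hom K2 A2) (p2 : hom A2 B2) SB :
  conflation i1 p1 -> conflation i2 p2 -> biproduct_of B1 B2 SB ->
  exists (SK SA : C) (i : hom SK SA) (p : hom SA SB),
    [/\ conflation i p, biproduct_of K1 K2 SK & biproduct_of A1 A2 SA].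
Proof.
move=> c1 c2 [b1 [b2 [b1' [b2' [bb1 bb2 bb3 bb4 bb5]]]]].
have [SA [a1 [a2 [a1' [a2' [aa1 aa2 aa3 aa4 aa5]]]]]] := exact_biproduct exC A1 A2.
have [SK [k1 [k2 [k1' [k2' [kk1 kk2 kk3 kk4 kk5]]]]]] := exact_biproduct exC K1 K2.
pose i := a1 \c i1 \c k1' + a2 \c i2 \c k2'.
pose p := b1 \c p1 \c a1' + b2 \c p2 \c a2'.
have ai1 : a1' \c i = i1 \c k1'.
  by rewrite comp_addr !compA aa1 aa3 comp_idl !comp0m addr0.
have ai2 : a2' \c i = i2 \c k2'.
  by rewrite comp_addr !compA aa2 aa4 comp_idl !comp0m add0r.
have bp1 : b1' \c p = p1 \c a1'.
  by rewrite comp_addr !compA bb1 bb3 comp_idl !comp0m addr0.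
have bp2 : b2' \c p = p2 \c a2'.
  by rewrite comp_addr !compA bb2 bb4 comp_idl !comp0m add0r.
have pa1 : p \c a1 = b1 \c p1.
  by rewrite comp_addl -!compA aa1 aa4 comp_idr !compm0 addr0.
have pa2 : p \c a2 = b2 \c p2.
  by rewrite comp_addl -!compA aa2 aa3 comp_idr !compm0 add0r.
exists SK, SA, i, p; split; last 2 first.
- by exists k1, k2, k1', k2'.
- by exists a1, a2, a1', a2'.
apply: kernel_epi_confl; last first.
  move=> T u v uv.
  have e1 : u \c b1 = v \c b1.
    by apply: (confl_epi exC c1); rewrite -!compA -pa1 !compA uv.
  have e2 : u \c b2 = v \c b2.
    by apply: (confl_epi exC c2); rewrite -!compA -pa2 !compA uv.
  by rewrite -(comp_idr u) -(comp_idr v) -bb5 !comp_addr !compA e1 e2.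
apply: mono_kernel => [T u v uv||T t pt].
- have e1 : k1' \c u = k1' \c v.
    by apply: (confl_mono exC c1); rewrite !compA -ai1 -!compA uv.
  have e2 : k2' \c u = k2' \c v.
    by apply: (confl_mono exC c2); rewrite !compA -ai2 -!compA uv.
  by rewrite -(comp_idl u) -(comp_idl v) -kk5 !comp_addl -!compA e1 e2.
- rewrite /p comp_addl -!compA ai1 ai2 !compA -(compA b1) -(compA b2).
  by rewrite (confl0 exC c1) (confl0 exC c2) !compm0 !comp0m addr0.
have [|u1 hu1] := kernel_lift (t := a1' \c t) (confl_kernel exC c1).
  by rewrite compA -bp1 -compA pt compm0.
have [|u2 hu2] := kernel_lift (t := a2' \c t) (confl_kernel exC c2).
  by rewrite compA -bp2 -compA pt compm0.
exists (k1 \c u1 + k2 \c u2).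
rewrite /i comp_addl !comp_addr -!compA (compA k1') (compA k2') (compA k1') (compA k2').
rewrite kk1 kk2 kk3 kk4 !comp_idl !comp0m !compm0 addr0 add0r hu1 hu2.
by rewrite !compA -comp_addl aa5 comp_idl.
Qed.

End AbelianResolutions.

(** * Auslander-Buchweitz approximations and left thickness *)

Section LeftThickHat.
Variables (C : abelianCat) (Y omega : set C).
Let exC := abelian_exact C.
Hypothesis thickY : left_thick Y.
Hypothesis sub_omega : omega `<=` Y.
Hypothesis cogen : forall M, Y M -> exists V M' (j : hom M V) (q : hom V M'),
  [/\ conflation j q, omega V & Y M'].
Hypothesis orth : forall k M N, Y M -> rhat omega k N -> spl M N.
Hypothesis zero_omega : exists2 Z, is_zero_ob Z & omega Z.
Implicit Types A B D K L M N S T Z V : C.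

Let extY : ext_closed Y. Proof. by case: thickY. Qed.
Let kerY : epi_ker_closed Y. Proof. by case: thickY. Qed.

Lemma hat_omega_subset k : rhat omega k `<=` rhat Y k.
Proof. exact: rhat_subset. Qed.

Lemma hatY_le k l : (k <= l)%N -> rhat Y k `<=` rhat Y l.
Proof.
by case: zero_omega => Z hZ oZ; apply: (rhat_le exC hZ); exact: sub_omega.
Qed.

Lemma hat_coresolution k M : rhat Y k M ->
  exists H Y' (j : hom M H) (q : hom H Y'),
    [/\ conflation j q, rhat omega k H & Y Y'].
Proof.
elim: k M => [|k IH] M; first exact: cogen.
move=> [K [A [i [p [c YA /IH [H [B [j [q [c1 hH YB]]]]]]]]]].
have [P [i' [p' [j' [q' [c2 c3 _ _ _]]]]]] := po_confl2 exC c c1.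
have [W [D [f [g [c4 oW YD]]]]] := cogen (extY c3 YA YB).
have [N [x [y [z [c5 c6 _ _]]]]] := comp_mono exC c2 c4.
by exists N, D, y, z; split=> //; exists H, W, (f \c i'), x.
Qed.

Lemma hat_resolution k M : rhat Y k.+1 M ->
  exists K A (i : hom K A) (p : hom A M),
    [/\ conflation i p, Y A & rhat omega k K].
Proof.
move=> [K [A [i [p [c YA /hat_coresolution [H [B [j [q [c1 hH YB]]]]]]]]]].
have [P [i' [p' [j' [q' [c2 c3 _ _ _]]]]]] := po_confl2 exC c c1.
by exists H, P, i', p'; split=> //; exact: extY c3 YA YB.
Qed.

(** A cover A ->> M restricts over K to P ->> K with the same kernel L, and P is in Y as the kernel
    of A ->> N. *)
Lemma hat_kernel_to_base k K M N (i : hom K M) (p : hom M N) :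
  conflation i p -> rhat Y k M -> Y N -> rhat Y k K.
Proof.
case: k => [|k] c; first exact: kerY c.
move=> [L [A [j [q [c1 YA hL]]]]] YN.
have [P [f [g [h [c2 c3 _ _]]]]] := comp_epi exC c1 c.
by exists L, P, g, h; split=> //; exact: kerY c2 YA YN.
Qed.

(** A horseshoe argument without projectives: A is first enlarged to H in the hat of omega, so that
    the cover Y2 ->> N lifts to the pushed-out extension B'. The original B is recovered as the
    kernel of B' ->> Y1. *)
Lemma hat_ext_closed k : ext_closed (rhat Y k).
Proof.
elim: k => [|k IH] A B N i p c; first exact: extY c.
move=> /hat_coresolution [H [Y1 [j [q [c1 [L [W [l [w [cH oW hL]]]]] YY1]]]]].
move=> hN; have [K [Y2 [f [g [c2 YY2 hK]]]]] := hN.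
have [B' [i' [p' [j' [q' [c3 c4 _ _ _]]]]]] := po_confl2 exC c c1.
apply: (hat_kernel_to_base c4) YY1.
have [P [x [y [x' [y' [c5 c6 _ _ _]]]]]] := pb_confl2 exC c3 c2.
(* The pullback of B' along Y2 ->> N is an extension of Y2 by H, which splits by [orth]; replacing H
   by its cover W then gives a cover S of B' whose kernel is an extension of K by L. *)
have [s hs] : exists s, y \c s = idm Y2.
  have hs : spl Y2 H by apply: (@orth k.+1) => //; exists L, W, l, w.
  exact: hs c5.
have [r hb] := split_biproduct (confl_kernel exC c5) hs.
have c7 := biproduct_confl exC (biproduct_sym hb).
have [S [u [v [u' [v' [c8 c9 _ _ _]]]]]] := pb_confl2 exC cH c7.
have [Q [a [b [b' [c10 c11 _ _]]]]] := comp_epi exC c8 c6.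
exists Q, S, a, (y' \c v); split=> //; first by apply: extY c9 YY2 _; exact: sub_omega.
exact: IH c11 (hat_omega_subset hL) hK.
Qed.

Lemma hat_epi_ker_closed k : epi_ker_closed (rhat Y k).
Proof.
case: k => [|k] A B N i p c hB; first exact: kerY c hB.
move=> hN; have [K [Y2 [f [g [c2 YY2 hK]]]]] := hN.
have [P [x [y [x' [y' [c5 c6 _ _ _]]]]]] := pb_confl2 exC c c2.
apply: hat_kernel_to_base c5 _ YY2; apply: hat_ext_closed c6 _ hB.
exact: hatY_le hK.
Qed.

(** Schanuel's comparison of two covers: the pullback P is an extension of A by L, and K is the
    kernel of P ->> B with B in Y. *)
Lemma hat_syzygy k K A M (i : hom K A) (p : hom A M) :
  conflation i p -> Y A -> rhat Y k.+1 M -> rhat Y k K.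
Proof.
move=> c YA [L [B [j [q [c1 YB hL]]]]].
have [P [x [y [x' [y' [c5 c6 _ _ _]]]]]] := pb_confl2 exC c c1.
apply: hat_kernel_to_base c5 _ YB; apply: hat_ext_closed c6 hL _.
exact: (hatY_le (leq0n k)) YA.
Qed.

(* If Y0 ->> S = A (+) B has Y0 in Y, and P1, P2 are the kernels of Y0 ->> A and
   Y0 ->> B, then P1 (+) P2 is the kernel of Y0 (+) Y0 ->> S, so the induction
   hypothesis makes its summand P1 a first syzygy of A of the right length. *)
Lemma hat_summand_closed k : summand_closed (rhat Y k).
Proof.
elim: k => [|k IH] A B S; first by case: thickY => _ _; apply.
move=> [i [j [p [q hb]]]] hS; have [K [Y0 [f [g [c YY0 hK]]]]] := hS.
have [P1 [a1 [_ [_ [c1 _ _ _]]]]] :=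
  comp_epi exC c (biproduct_confl exC (biproduct_sym hb)).
have [P2 [a2 [_ [_ [c2 _ _ _]]]]] := comp_epi exC c (biproduct_confl exC hb).
exists P1, Y0, a1, (p \c g); split=> //.
have hAB : biproduct_of A B S by exists i, j, p, q.
have [SK [SA [x [y [c3 hP [k1 [k2 [k1' [k2' hY0]]]]]]]]] := sum_confl c1 c2 hAB.
apply: (IH P1 P2 SK hP); apply: (hat_syzygy c3) hS.
exact: (extY (biproduct_confl exC hY0) YY0 YY0).
Qed.

Lemma hat_left_thick k : left_thick (rhat Y k).
Proof.
by split; [exact: hat_ext_closed|exact: hat_epi_ker_closed|exact: hat_summand_closed].
Qed.

End LeftThickHat.

(** * Orthogonality to finite omega-resolutions *)

Section HatOrthogonality.
Variables (E : conflCat) (Y omega : set E).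
Hypothesis exE : is_exact_cat E.
Implicit Types A B D K L M N S T Z V : E.

(** Lift the cover [x] of M to [f : X -> F]. On the kernel T it restricts to a map into N, which
    lifts to W by induction and extends to X because Ext^1(M, W) = 0. Subtracting this correction
    makes [f] vanish on T, hence descend to a section. *)
Lemma hat_orth :
  (forall M V, Y M -> omega V -> spl M V) ->
  (forall M, Y M -> exists T X (t : hom T X) (x : hom X M),
    [/\ conflation t x, Y T & forall k N, rhat omega k N -> spl X N]) ->
  forall k M N, Y M -> rhat omega k N -> spl M N.
Proof.
move=> h1 h2; elim=> [|k IH] M N YM; first exact: h1.
move=> hN F i p c; have [L [W [l [w [cW oW hL]]]]] := hN.
have [T [X [t [x [cX YT hX]]]]] := h2 M YM.
have [f pf] := spl_lift exE x (hX _ _ hN) c.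
have [|g hg] := kernel_lift (t := f \c t) (confl_kernel exE c).
  by rewrite compA pf (confl0 exE cX).
have [g' hg'] := spl_lift exE g (IH _ _ YT hL) cW.
have [h ht] := spl_extend exE g' (h1 _ _ YM oW) cX.
have [|s hs] := cokernel_ext (t := f - i \c (w \c h)) (confl_cokernel exE cX).
  by rewrite compBm -!compA ht hg' hg subrr.
exists s; apply: (confl_epi exE cX); rewrite -compA hs compmB pf compA.
by rewrite (confl0 exE c) comp0m subr0 comp_idl.
Qed.

End HatOrthogonality.

(** * Orthogonality for kernels of deflations *)

Section Cotorsion.
Variables (E : conflCat) (X T : set E).
Hypothesis exE : is_exact_cat E.
Hypothesis orthXT : forall M N, X M -> T N -> spl M N.
Hypothesis preenv : forall M, exists B A (i : hom M B) (p : hom B A),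
  [/\ conflation i p, T B & X A].
Hypothesis cokerT : mono_coker_closed T.
Implicit Types A B D F K L M N P S Z V : E.

(* The extension N >-> F ->> K is induced from N >-> B ->> B/N, with F >-> B
   and B, hence B/N, in T; the inclusion of K into B/N extends to M. *)
Lemma spl_epi_kernel K M X2 N (k : hom K M) (q : hom M X2) :
  conflation k q -> X X2 -> T N -> spl M N -> spl K N.
Proof.
move=> c hX2 TN hMN F i p cF.
have [B [A [j [r [cB TB XA]]]]] := preenv F.
have [P [u [j' [q' [c1 c2 q'u uj]]]]] := comp_mono exE cF cB.
have TP : T P := cokerT c1 TN TB.
have [g gk] := spl_extend exE j' (orthXT hX2 TP) c.
have [h uh] := spl_lift exE g hMN c1.
have [|s hs] := kernel_lift (t := h \c k) (confl_kernel exE cB).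
  by rewrite -q'u -compA (compA u) uh gk (confl0 exE c2).
exists s; apply: (confl_mono exE c2).
by rewrite compA -uj -compA hs compA uh gk comp_idr.
Qed.

End Cotorsion.

(** * Vanishing of higher Ext *)

Section Hereditary.
Variable E : conflCat.
Hypothesis exE : is_exact_cat E.
Implicit Types A B K L M N S T : E.

Lemma yext_map_id k M N (s : yext k M N) : yext_map (idm M) (idm N) s s.
Proof.
elim: k M N s => [|k IH] M N /=.
  by move=> s; exists (idm _); rewrite !comp_idl !comp_idr.
move=> [K [s s']]; exists (idm _), (idm _).
by rewrite !comp_idl !comp_idr; split=> //; exact: IH.
Qed.

Lemma yext_pullback k M M' N (u : hom M' M) (s : yext k M N) :
  exists s' : yext k M' N, yext_map u (idm N) s' s.
Proof.
case: k s => [|k] /=.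
  move=> s; have [B [i [p [b [c bi pb _]]]]] := pb_confl exE u (ext1_conflation s).
  by exists (Ext1 c), b => /=; rewrite bi comp_idr.
move=> [K [s s']].
have [B [i [p [b [c bi pb _]]]]] := pb_confl exE u (ext1_conflation s).
exists (existT _ K (Ext1 c, s')), (idm K), b => /=.
by rewrite bi comp_idr; split=> //; exact: yext_map_id.
Qed.

Lemma yext_equiv_splice k M N K (s : ext1 M K) (t t' : yext k K N) :
  yext_equiv t t' -> @yext_equiv _ k.+1 _ _ (existT _ K (s, t)) (existT _ K (s, t')).
Proof.
elim=> {t t'} [t t' h|t|t t' _ h|t t' t'' _ h1 _ h2].
- by apply: rst_step; exists (idm _), (idm _); rewrite !comp_idl !comp_idr.
- exact: rst_refl.
- exact: rst_sym.
- exact: rst_trans h1 h2.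
Qed.

(* Two (k+2)-fold extensions of M are both refined by extensions whose last
   term covers the pullback of their last terms; over that common syzygy, which
   is again in P, the induction hypothesis compares the remaining parts. *)
Lemma hereditary_resolving (P D : set E) :
  (forall M, exists B A (i : hom B A) (p : hom A M), conflation i p /\ P A) ->
  epi_ker_closed P -> (forall M N, P M -> D N -> spl M N) -> hereditary_pair P D.
Proof.
move=> cover kerP orthP A B i; case: i => // k PA DB _; rewrite /Ext_zero /=.
elim: k A PA => [|k IH] M PM; first exact/(Ext_zero1 exE)/orthP.
move=> [K [s s']] [L [t t']].
have [S [i [p [j [q [c1 c2 qi pj e]]]]]] :=
  pb_confl2 exE (ext1_conflation s) (ext1_conflation t).
have [S1 [l1 [? [? [c3 _ _ _]]]]] := comp_epi exE c1 (ext1_conflation t).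
have [F [S0 [? [f [c4 PS0]]]]] := cover S.
have [J [x [? [? [c5 _ _ _]]]]] := comp_epi exE c4 c3.
have PJ : P J := kerP _ _ _ _ _ c5 PS0 PM.
have [|u hu] := kernel_lift (t := q \c f \c x)
  (confl_kernel exE (ext1_conflation s)).
  by rewrite !compA e (confl0 exE c5).
have [|v hv] := kernel_lift (t := p \c f \c x)
  (confl_kernel exE (ext1_conflation t)).
  by rewrite !compA (confl0 exE c5).
have [s'' hs] := yext_pullback u s'.
have [t'' ht] := yext_pullback v t'.
apply: (@rst_trans _ _ _ (existT _ J (Ext1 c5, s''))).
  apply/rst_sym/rst_step; exists u, (q \c f); split=> //=.
  by rewrite comp_idl compA e -compA.
apply: (@rst_trans _ _ _ (existT _ J (Ext1 c5, t''))).
  exact/yext_equiv_splice/IH.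
apply: rst_step; exists v, (p \c f); split=> //=.
by rewrite comp_idl compA.
Qed.

End Hereditary.

(** * Splitting and idempotents in a full subcategory *)

Section FullSubcategory.
Variables (E : conflCat) (P : set E).
Hypotheses (exE : is_exact_cat E) (extP : ext_closed P).

Lemma full_spl (A B : full_exact P) : spl A B <-> @spl E (sval A) (sval B).
Proof.
split=> h; last by move=> T i p c; exact: h c.
by move=> T i p c; apply: (h (exist _ T (extP c (svalP B) (svalP A))) i p c).
Qed.

Lemma full_wic : is_abelian E -> summand_closed P ->
  weakly_idempotent_complete (full_exact P).
Proof.
case=> _ hker _ _ _ sP A B r s rs.
have [K [k hk]] := hker _ _ r.
have [l hb] := split_biproduct hk rs.
have PK : P K by apply: (sP K (sval A) (sval B) _ (svalP B)); exists k, s, l, r.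
exists (exist _ K PK), k; case: hk => rk hk; split=> // T t; exact: hk.
Qed.

End FullSubcategory.

(** * The Hovey triple *)

Section HoveyTriple.
Variables (C : abelianCat) (X Y omega : set C) (m : nat).
Hypotheses (hX : cotorsion_pair X (perp X)) (hXcomp : complete_pair X (perp X))
  (hY : frobenius_pair Y omega) (hthick : thick (perp X)) (hXY : X `<=` Y)
  (homega : X `&` perp X = omega)
  (hcot : cotorsion_pair (hat omega m) (rperp 1 (hat omega m)))
  (hcomp : complete_pair (hat omega m) (rperp 1 (hat omega m))).
Variable n : nat.
Hypothesis hmn : (m <= n)%N.
Let exC := abelian_exact C.
Implicit Types A B D K L M N S T Z V : C.

Lemma cotorsion_splP M : X M <-> forall N, perp X N -> spl M N.
Proof.
split=> [XM N TN | h]; first by apply/(Ext_zero1 exC)/(TN 1%N).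
by have [_ ->] := hX; move=> N TN; apply/(Ext_zero1 exC)/h.
Qed.

(** Orthogonality in all degrees can be tested in degree one, since the cotorsion pair identifies
    [rperp 1 X] with [perp X]. *)
Lemma perp_splP N : perp X N <-> forall M, X M -> spl M N.
Proof.
split=> [TN M XM | h]; first by apply/(Ext_zero1 exC)/(TN 1%N).
by have [<- _] := hX; move=> M XM; apply/(Ext_zero1 exC)/h.
Qed.

Lemma perp_orth M N : X M -> perp X N -> spl M N.
Proof. by move=> XM /perp_splP; apply. Qed.

Lemma X_ext_closed : ext_closed X.
Proof.
move=> A B N i p c XA XN; apply/cotorsion_splP => V TV.
exact: (spl_extl exC c (perp_orth XA TV) (perp_orth XN TV)).
Qed.

Lemma X_summand_closed : summand_closed X.
Proof.
move=> A B S h XS; apply/cotorsion_splP => V TV.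
exact: (spl_summandl exC h (perp_orth XS TV)).
Qed.

Lemma perp_ext_closed : ext_closed (perp X). Proof. by case: hthick => -[]. Qed.
Lemma perp_mono_coker : mono_coker_closed (perp X). Proof. by case: hthick. Qed.

Lemma X_preenvelope M : exists B A (i : hom M B) (p : hom B A),
  [/\ conflation i p, perp X B & X A].
Proof. by have [] := hXcomp M. Qed.

Lemma X_spl_epi_kernel K M V N (k : hom K M) (q : hom M V) :
  conflation k q -> X V -> perp X N -> spl M N -> spl K N.
Proof. exact: (spl_epi_kernel exC perp_orth X_preenvelope perp_mono_coker). Qed.

Lemma X_left_thick : left_thick X.
Proof.
split; [exact: X_ext_closed| |exact: X_summand_closed].
move=> A B N i p c XB XN; apply/cotorsion_splP => V TV.
exact: (X_spl_epi_kernel c XN TV (perp_orth XB TV)).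
Qed.

Lemma omegaP M : omega M <-> X M /\ perp X M.
Proof. by rewrite -homega. Qed.

Lemma omega_zero Z : is_zero_ob Z -> omega Z.
Proof.
move=> hZ; apply/omegaP; split; first by apply/cotorsion_splP => N _; exact: zero_spll.
by apply/perp_splP => N _; exact: zero_splr.
Qed.

Lemma omega_has_zero : exists2 Z, is_zero_ob Z & omega Z.
Proof. by have [Z hZ] := exact_zero exC; exists Z => //; exact: omega_zero. Qed.

Lemma omega_subX : omega `<=` X. Proof. by move=> M /omegaP []. Qed.
Lemma omega_subY : omega `<=` Y. Proof. by move=> M /omega_subX /hXY. Qed.

Lemma hatXE k : hat X k = rhat X k.
Proof.
have [Z _ oZ] := omega_has_zero; apply: (hatE _ X_summand_closed).
by exists Z; exact: omega_subX.
Qed.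

Lemma hatYE k : hat Y k = rhat Y k.
Proof.
have [Z _ oZ] := omega_has_zero; apply: hatE; first by case: hY => -[].
by exists Z; exact: omega_subY.
Qed.

Lemma hat_omegaE k : hat omega k = rhat omega k.
Proof.
by have [Z _ oZ] := omega_has_zero; apply: hatE; [case: hY | exists Z].
Qed.

Lemma hat_omega_perp k : rhat omega k `<=` perp X.
Proof.
apply: subset_trans (rhat_mono_coker perp_mono_coker).
by apply: rhat_subset => M /omegaP [].
Qed.

Lemma X_cogen M : X M -> exists V M' (j : hom M V) (q : hom V M'),
  [/\ conflation j q, omega V & X M'].
Proof.
move=> XM; have [B [A [i [p [c TB XA]]]]] := X_preenvelope M.
by exists B, A, i, p; split=> //; apply/omegaP; split=> //; exact: X_ext_closed c XM XA.
Qed.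

Lemma X_orth k M N : X M -> rhat omega k N -> spl M N.
Proof. by move=> XM /hat_omega_perp; exact: perp_orth. Qed.

(** The kernel of the X-cover of M is again in Y because X is contained in Y, and X itself is
    orthogonal to the hats of omega since these lie in [perp X]. *)
Lemma Y_orth k M N : Y M -> rhat omega k N -> spl M N.
Proof.
have [[extY kerY _] _ h3 _] := hY.
move: k M N; apply: (hat_orth exC) => [M V YM oV|M YM].
  exact/(Ext_zero1 exC)/h3.
have [[B [A [i [p [c TB XA]]]]] _] := hXcomp M.
exists B, A, i, p; split=> //; first exact: kerY c (hXY XA) YM.
by move=> k N; exact: X_orth.
Qed.

Lemma Y_cogen M : Y M -> exists V M' (j : hom M V) (q : hom V M'),
  [/\ conflation j q, omega V & Y M'].
Proof. by case: hY => _ _ _ [_]; apply. Qed.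

(** The pair (X, omega) meets the same requirements as (Y, omega), so one argument serves both
    hats. *)
Lemma hatX_left_thick k : left_thick (hat X k).
Proof.
rewrite hatXE; exact: (hat_left_thick X_left_thick omega_subX X_cogen X_orth omega_has_zero).
Qed.

Lemma hatY_left_thick k : left_thick (hat Y k).
Proof.
have [ltY _ _ _] := hY.
rewrite hatYE; exact: (hat_left_thick ltY omega_subY Y_cogen Y_orth omega_has_zero).
Qed.

Lemma Y_sub_hat k : Y `<=` hat Y k.
Proof.
rewrite hatYE; have [Z hZ oZ] := omega_has_zero.
exact: (rhat_le exC hZ (omega_subY oZ) (leq0n k)).
Qed.

Lemma hatX_sub_hatY : hat X m `<=` hat Y n.
Proof.
rewrite hatXE hatYE; have [Z hZ oZ] := omega_has_zero.
apply: subset_trans (rhat_le exC hZ (omega_subY oZ) hmn).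
exact: rhat_subset.
Qed.

Lemma X_sub_hat k : X `<=` hat X k.
Proof.
rewrite hatXE; have [Z hZ oZ] := omega_has_zero.
exact: (rhat_le exC hZ (omega_subX oZ) (leq0n k)).
Qed.

(** In the approximation K >-> A ->> M the kernel K lies in [perp X]; if M does too, so does A,
    which is then in omega. *)
Lemma hatX_perp : hat X m `&` perp X = hat omega m.
Proof.
rewrite hatXE hat_omegaE; apply/seteqP; split=> M; last first.
  by move=> h; split; [exact: (rhat_subset omega_subX h)|exact: (hat_omega_perp h)].
move=> [hM TM]; case: m hM => [|k] hM; first by apply/omegaP.
have [K [A [i [p [c XA hK]]]]] := hat_resolution X_left_thick X_cogen hM.
exists K, A, i, p; split=> //; apply/omegaP; split=> //.
exact: perp_ext_closed c (hat_omega_perp hK) TM.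
Qed.

Notation Yn := (hat Y n).
Notation BB := (rperp 1 (hat omega m)).

Lemma hat_omega_sub_hatX : hat omega m `<=` hat X m.
Proof. by rewrite -hatX_perp => M []. Qed.

Lemma hat_omega_orth M N : hat omega m M -> BB N -> spl M N.
Proof. by move=> hM /(_ M hM) /(Ext_zero1 exC). Qed.

(** M is the kernel of a deflation H ->> V with H in the hat of omega and V in X, and splitting
    passes from H to M. *)
Lemma hatX_orth M N : hat X m M -> perp X N -> BB N -> spl M N.
Proof.
rewrite hatXE => /(hat_coresolution X_left_thick X_cogen).
move=> [H [V [j [q [c hH XV]]]]] TN BN.
by apply: (X_spl_epi_kernel c XV TN); apply: hat_omega_orth => //; rewrite hat_omegaE.
Qed.

Let extYn : ext_closed Yn. Proof. by case: (hatY_left_thick n). Qed.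

Lemma Yn_has_zero : exists2 Z, is_zero_ob Z & Yn Z.
Proof.
by have [Z hZ oZ] := omega_has_zero; exists Z => //; apply/Y_sub_hat/omega_subY.
Qed.

Lemma Yn_exact : is_exact_cat (full_exact Yn).
Proof. exact: full_exact_is_exact exC extYn Yn_has_zero. Qed.
Let exE := Yn_exact.

Notation E := (full_exact Yn).
Notation Q := (restr Yn (hat X m)).
Notation W := (restr Yn (perp X `&` Yn)).
Notation R := (restr Yn (BB `&` Yn)).

Lemma W_thick : thick W.
Proof.
have [[t1 t2 t3] t4] := hthick.
split; first split.
- move=> A B N i p c [TA _] [TN _]; split; last exact: svalP.
  exact: t1 c TA TN.
- move=> A B N i p c [TB _] [TN _]; split; last exact: svalP.
  exact: t2 c TB TN.
- move=> A B S [i [j [p [q [h1 h2 h3 h4 h5]]]]] [TS _]; split; last exact: svalP.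
  by apply: (t3 (sval A) (sval B) (sval S)) => //; exists i, j, p, q.
- move=> A B N i p c [TA _] [TB _]; split; last exact: svalP.
  exact: t4 c TA TB.
Qed.

Lemma QW_spl (A B : E) : (Q `&` W) A -> R B -> spl A B.
Proof.
move=> [QA [TA _]] [RB _]; apply/(full_spl extYn); apply: hat_omega_orth RB.
by rewrite -hatX_perp.
Qed.

Lemma Q_spl (A B : E) : Q A -> (W `&` R) B -> spl A B.
Proof.
move=> QA [[TB _] [RB _]]; apply/(full_spl extYn); exact: hatX_orth.
Qed.

(** The approximations of the ambient pair remain in hat Y n, one by closure under kernels and the
    other by closure under extensions. *)
Lemma complete_QW : complete_pair (Q `&` W) R.
Proof.
have [_ kerYn _] := hatY_left_thick n.
move=> [M YM].
have [[B [A [i [p [c BB' A']]]]] [B1 [A1 [j [q [c1 BB1 A1']]]]]] := hcomp M.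
have YA : Yn A by apply/hatX_sub_hatY/hat_omega_sub_hatX.
have YA1 : Yn A1 by apply/hatX_sub_hatY/hat_omega_sub_hatX.
have YB : Yn B := kerYn _ _ _ _ _ c YA YM.
have YB1 : Yn B1 := extYn c1 YM YA1.
have [XA TA] : (hat X m `&` perp X) A by rewrite hatX_perp.
have [XA1 TA1] : (hat X m `&` perp X) A1 by rewrite hatX_perp.
split; first by exists (exist _ B YB), (exist _ A YA), i, p.
by exists (exist _ B1 YB1), (exist _ A1 YA1), j, q.
Qed.

Lemma complete_Q : complete_pair Q (W `&` R).
Proof.
have [extXm _ _] := hatX_left_thick m.
have [_ kerYn _] := hatY_left_thick n.
have approx M : Yn M -> exists B A (i : hom M B) (p : hom B A),
    [/\ conflation i p, BB B, hat omega m A & Yn B].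
  move=> YM; have [_ [B1 [A1 [j [q [c1 BB1 A1']]]]]] := hcomp M.
  exists B1, A1, j, q; split=> //; apply: (extYn c1 YM).
  exact/hatX_sub_hatY/hat_omega_sub_hatX.
have XYn M : X M -> Yn M by move=> /hXY /Y_sub_hat; apply.
move=> [M YM]; have [[T0 [X0 [i [p [c TT0 XX0]]]]] _] := hXcomp M.
split.
  have YT0 : Yn T0 := kerYn _ _ _ _ _ c (XYn _ XX0) YM.
  have [B [A [j [q [c1 hB hA YB]]]]] := approx T0 YT0.
  (* The pushout along T0 >-> B turns the kernel T0 into B and enlarges X0 to P, an extension of A
     by X0. *)
  have [P [i' [p' [j' [q' [c2 c3 _ _ _]]]]]] := po_confl2 exC c c1.
  have TA : perp X A by move: hA; rewrite -hatX_perp => -[].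
  have hP : hat X m P.
    by apply: extXm c3 _ _; [exact: X_sub_hat | exact: hat_omega_sub_hatX].
  exists (exist _ B YB), (exist _ P (hatX_sub_hatY hP)), i', p'; split=> //.
  by split; split=> //; exact: perp_ext_closed c1 TT0 TA.
have [T1 [X1 [j [q [c1 TT1 XX1]]]]] := X_preenvelope M.
have YT1 : Yn T1 := extYn c1 YM (XYn _ XX1).
have [B [A [f [g [c2 hB hA YB]]]]] := approx T1 YT1.
have TA : perp X A by move: hA; rewrite -hatX_perp => -[].
(* The cokernel P of M >-> T1 >-> B is an extension of A by X1. *)
have [P [k [j' [q' [c3 c4 _ _]]]]] := comp_mono exC c1 c2.
have hP : hat X m P.
  by apply: extXm c4 _ _; [exact: X_sub_hat | exact: hat_omega_sub_hatX].
exists (exist _ B YB), (exist _ P (hatX_sub_hatY hP)), (f \c j), k; split=> //.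
by split; split=> //; exact: perp_ext_closed c2 TT1 TA.
Qed.

(** For the right class, the test objects of the ambient pair already lie in hat Y n. For the left
    class, an object orthogonal to R splits off its own approximation, and both defining classes are
    closed under summands. *)
Lemma cotorsion_QW : cotorsion_pair (Q `&` W) R.
Proof.
split; apply/seteqP; split=> A.
- move=> h; split; last exact: svalP.
  move=> M hM; have YM : Yn M by apply/hatX_sub_hatY/hat_omega_sub_hatX.
  apply/(Ext_zero1 exC).
  apply: ((full_spl extYn (exist _ M YM) A).1); apply/(Ext_zero1 exE)/h.
  by move: hM; rewrite -hatX_perp => -[].
- by move=> RA M hM; apply/(Ext_zero1 exE)/QW_spl.
- by move=> hA N RN; apply/(Ext_zero1 exE)/QW_spl.
move=> h; have [[B [D [i [p [c RB [QD [TD _]]]]]]] _] := complete_QW A.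
have [s ps] := (Ext_zero1 exE _ _).1 (h B RB) _ _ _ c.
have [_ _ sX] := hatX_left_thick m; have [[_ _ sT] _] := hthick.
split; last split; last exact: svalP.
- exact: (section_summand exC sX c ps).
- exact: (section_summand exC sT c ps).
Qed.

Lemma cotorsion_Q : cotorsion_pair Q (W `&` R).
Proof.
split; apply/seteqP; split=> A.
- move=> h.
  have hA M : hat X m M -> spl M (sval A).
    move=> hM; apply: ((full_spl extYn (exist _ M (hatX_sub_hatY hM)) A).1).
    exact/(Ext_zero1 exE)/h.
  split; split; try exact: svalP.
    by apply/perp_splP => M XM; apply/hA/X_sub_hat.
  by move=> M hM; apply/(Ext_zero1 exC)/hA/hat_omega_sub_hatX.
- by move=> RA M hM; apply/(Ext_zero1 exE)/Q_spl.
- by move=> hA N RN; apply/(Ext_zero1 exE)/Q_spl.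
move=> h; have [[B [D [i [p [c RB QD]]]]] _] := complete_Q A.
have [s ps] := (Ext_zero1 exE _ _).1 (h B RB) _ _ _ c.
have [_ _ sX] := hatX_left_thick m.
exact: (section_summand exC sX c ps).
Qed.

Lemma Q_epi_ker_closed : epi_ker_closed Q.
Proof.
have [_ h _] := hatX_left_thick m.
by move=> A B N i p c; exact: h c.
Qed.

Lemma hereditary_QW : hereditary_pair (Q `&` W) R.
Proof.
apply: (hereditary_resolving exE) => [M||]; last exact: QW_spl.
  have [[B [A [i [p [c _ hA]]]]] _] := complete_QW M.
  by exists B, A, i, p.
move=> A B N i p c [QB WB] [QN WN]; split; first exact: Q_epi_ker_closed c QB QN.
by have [[_ h _] _] := W_thick; exact: h c WB WN.
Qed.

Lemma hereditary_Q : hereditary_pair Q (W `&` R).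
Proof.
apply: (hereditary_resolving exE) => [M||]; last exact: Q_spl.
  have [[B [A [i [p [c _ hA]]]]] _] := complete_Q M.
  by exists B, A, i, p.
exact: Q_epi_ker_closed.
Qed.

Lemma hovey_QWR : hereditary_hovey_triple Q W R.
Proof.
split; [split| |].
- exact: W_thick.
- by split; [exact: cotorsion_QW|exact: complete_QW].
- by split; [exact: cotorsion_Q|exact: complete_Q].
- exact: hereditary_QW.
- exact: hereditary_Q.
Qed.

Lemma Yn_wic : weakly_idempotent_complete E.
Proof.
by apply: full_wic; [exact: abelianP | have [] := hatY_left_thick n].
Qed.

Lemma trivially_bifibrant :
  hat X m `&` (perp X `&` Yn) `&` (BB `&` Yn) = hat omega m `&` BB.
Proof.
rewrite -hatX_perp; apply/seteqP; split=> M; first by move=> [[? [? ?]] [? ?]].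
move=> [[hM TM] BM]; have YM := hatX_sub_hatY hM.
by split; split.
Qed.

End HoveyTriple.

(** * The homotopy category *)

Section CategoryFacts.
Variable C : category.
Implicit Types A B D : C.

Lemma iso_comp A B D (g : hom B D) (f : hom A B) :
  is_iso f -> is_iso g -> is_iso (g \c f).
Proof.
move=> [f' [ff ff']] [g' [gg gg']]; exists (f' \c g'); split.
  by rewrite -compA (compA g') gg comp_idl.
by rewrite -compA (compA f) ff' comp_idl.
Qed.

Lemma iso_cancel A B D (f : hom A B) (g h : hom B D) :
  is_iso f -> g \c f = h \c f -> g = h.
Proof.
by move=> [f' [_ ff]] e; rewrite -(comp_idr g) -(comp_idr h) -ff !compA e.
Qed.

End CategoryFacts.

Lemma fmap_iso (C D : category) (F : functor C D) (A B : C) (f : hom A B) :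
  is_iso f -> is_iso (fmap F f).
Proof.
by move=> [g [gf fg]]; exists (fmap F g); rewrite -!fmap_comp gf fg !fmap_id.
Qed.

(** * The localization attached to a Hovey triple *)

Section HoveyLocalization.
Variables (E : conflCat) (Q W R : set E).
Hypotheses (exE : is_exact_cat E) (hov : hovey_triple Q W R)
  (kerQ : epi_ker_closed Q).
Implicit Types A B D K M N T Z : E.

Lemma hovey_spl_QW A B : (Q `&` W) A -> R B -> spl A B.
Proof.
have [_ [[<- _] _] _] := hov.
by move=> hA hB; apply/(Ext_zero1 exE)/hB.
Qed.

Lemma hovey_spl_Q A B : Q A -> (W `&` R) B -> spl A B.
Proof.
have [_ _ [[<- _] _]] := hov.
by move=> hA hB; apply/(Ext_zero1 exE)/hB.
Qed.

Lemma hovey_ext_Q : ext_closed Q.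
Proof.
have [_ _ [[_ hQ] _]] := hov.
move=> A B N i p c QA QN; rewrite hQ => V hV; apply/(Ext_zero1 exE).
exact: (spl_extl exE c (hovey_spl_Q QA hV) (hovey_spl_Q QN hV)).
Qed.

Lemma hovey_ext_R : ext_closed R.
Proof.
have [_ [[hR _] _] _] := hov.
move=> A B N i p c RA RN; rewrite -hR => V hV; apply/(Ext_zero1 exE).
exact: (spl_extr exE c (hovey_spl_QW hV RA) (hovey_spl_QW hV RN)).
Qed.

Lemma hovey_ext_W : ext_closed W.
Proof. by have [[[]]] := hov. Qed.

Let triv := Q `&` W `&` R.

Lemma hovey_zero Z : is_zero_ob Z -> triv Z.
Proof.
move=> hZ; have [_ [[hR hQW] _] _] := hov; split.
  by rewrite hQW => N _; apply/(Ext_zero1 exE)/zero_spll.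
by rewrite -hR => N _; apply/(Ext_zero1 exE)/zero_splr.
Qed.

Lemma triv_biproduct A B S : biproduct_of A B S -> triv A -> triv B -> triv S.
Proof.
move=> [i [j [p [q /(biproduct_confl exE) c]]]] [[QA WA] RA] [[QB WB] RB].
split; first split.
- exact: hovey_ext_Q c QA QB.
- exact: hovey_ext_W c WA WB.
- exact: hovey_ext_R c RA RB.
Qed.

(** Defined between arbitrary objects, so that maps of cofibrant replacements can be compared before
    passing to bifibrant ones. *)
Definition htp A B (f g : hom A B) : Prop :=
  exists T (a : hom A T) (b : hom T B), triv T /\ f - g = b \c a.

Lemma htp_refl A B (f : hom A B) : htp f f.
Proof.
have [Z hZ] := exact_zero exE; exists Z, 0, 0; split; first exact: hovey_zero.
by rewrite subrr comp0m.
Qed.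

Lemma htp_sym A B (f g : hom A B) : htp f g -> htp g f.
Proof.
move=> [T [a [b [hT e]]]]; exists T, a, (- b); split=> //.
by rewrite compNm -e opprB.
Qed.

Lemma htp_trans A B (f g h : hom A B) : htp f g -> htp g h -> htp f h.
Proof.
move=> [T [a [b [hT e]]]] [T' [a' [b' [hT' e']]]].
have [S [i [j [p [q hb]]]]] := exact_biproduct exE T T'.
have hS : biproduct_of T T' S by exists i, j, p, q.
case: hb => pi qj pj qi _.
exists S, (i \c a + j \c a'), (b \c p + b' \c q); split.
  exact: triv_biproduct hS hT hT'.
rewrite comp_addl !comp_addr -!compA (compA p) (compA p) (compA q) (compA q).
rewrite pi qj pj qi !comp_idl !comp0m !compm0 addr0 add0r -e -e'.
by rewrite addrA subrK.
Qed.

Lemma htp_compl A B D (g : hom B D) (f f' : hom A B) :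
  htp f f' -> htp (g \c f) (g \c f').
Proof.
move=> [T [a [b [hT e]]]]; exists T, a, (g \c b); split=> //.
by rewrite -compmB e compA.
Qed.

Lemma htp_compr A B D (f f' : hom B D) (g : hom A B) :
  htp f f' -> htp (f \c g) (f' \c g).
Proof.
move=> [T [a [b [hT e]]]]; exists T, (a \c g), b; split=> //.
by rewrite -compBm e compA.
Qed.

Lemma tfib_lift A' A M (p : hom A' A) (f : hom M A) :
  trivial_fibration W R p -> Q M -> exists g, p \c g = f.
Proof.
by move=> [K [i [c hK]]] QM; exact: (spl_lift exE f (hovey_spl_Q QM hK) c).
Qed.

Lemma tcof_extend A B M (i : hom A B) (f : hom A M) :
  trivial_cofibration Q W i -> R M -> exists g, g \c i = f.
Proof.
by move=> [K [p [c hK]]] RM; exact: (spl_extend exE f (hovey_spl_QW hK RM) c).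
Qed.

(** After lifting the homotopy, f - g differs from it by a map into the kernel K. K has an
    approximation P ->> K with P in Q and kernel in W and R; P is then trivially bifibrant, and the
    map lifts to it. *)
Lemma htp_cancel_tfib A' A M (p : hom A' A) (f g : hom M A') :
  trivial_fibration W R p -> Q M -> htp (p \c f) (p \c g) -> htp f g.
Proof.
move=> tp QM [T [a [b [hT e]]]].
have [b' hb'] := tfib_lift b tp hT.1.1.
have [K [k [c hK]]] := tp.
have [|u hu] := kernel_lift (t := f - g - b' \c a) (confl_kernel exE c).
  by rewrite !compmB compA hb' -e subrr.
have [_ _ [_ /(_ K) [[D [P [d [s [c2 hD QP]]]]] _]]] := hov.
have [v hv] := spl_lift exE u (hovey_spl_Q QM hD) c2.
have hP : triv P.
  split; first split=> //; first exact: hovey_ext_W c2 hD.1 hK.1.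
  exact: hovey_ext_R c2 hD.2 hK.2.
have fz : htp (f - b' \c a) g.
  by exists P, v, (k \c s); split=> //; rewrite -compA hv hu addrAC.
apply: htp_trans fz; exists T, a, b'; split=> //.
by rewrite opprB addrC subrK.
Qed.

(** Dual argument: the cokernel N embeds in an object of R with cokernel in Q and W, and that object
    is trivially bifibrant. *)
Lemma htp_cancel_tcof A B M (i : hom A B) (f g : hom B M) :
  trivial_cofibration Q W i -> R M -> htp (f \c i) (g \c i) -> htp f g.
Proof.
move=> ti RM [T [a [b [hT e]]]].
have [a' ha'] := tcof_extend a ti hT.2.
have [N [p [c hN]]] := ti.
have [|u hu] := cokernel_ext (t := f - g - b \c a') (confl_cokernel exE c).
  by rewrite !compBm -compA ha' -e subrr.
have [_ [_ /(_ N) [_ [P [D [d [s [c2 RP hD]]]]]]] _] := hov.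
have [v hv] := spl_extend exE u (hovey_spl_QW hD RM) c2.
have hP : triv P.
  split=> //; split; first exact: hovey_ext_Q c2 hN.1 hD.1.
  exact: hovey_ext_W c2 hN.2 hD.2.
have fz : htp (f - b \c a') g.
  by exists P, (d \c p), v; split=> //; rewrite compA hv hu addrAC.
apply: htp_trans fz; exists T, a', b; split=> //.
by rewrite opprB addrC subrK.
Qed.

Lemma tfib_id A : trivial_fibration W R (idm A).
Proof.
have [Z hZ] := exact_zero exE; exists Z, 0; split; first exact: confl_id0.
by have [[_ WZ] RZ] := hovey_zero hZ.
Qed.

Lemma tcof_id A : trivial_cofibration Q W (idm A).
Proof.
have [Z hZ] := exact_zero exE; exists Z, 0; split; first exact: confl_id.
by have [] := hovey_zero hZ.
Qed.

Lemma tfib_we A B (p : hom A B) :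
  trivial_fibration W R p -> weak_equivalence Q W R p.
Proof.
by move=> tp; exists A, (idm A), p; rewrite comp_idr; split=> //; exact: tcof_id.
Qed.

Lemma tcof_we A B (i : hom A B) :
  trivial_cofibration Q W i -> weak_equivalence Q W R i.
Proof.
by move=> ti; exists B, i, (idm B); rewrite comp_idl; split=> //; exact: tfib_id.
Qed.

(* f and g are the composites of (g, b) : A (+) T -> B with two sections of the
   trivial fibration A (+) T -> A. *)
Lemma inverts_htp (D : category) (F : functor E D) A B (f g : hom A B) :
  inverts F (@weak_equivalence E Q W R) -> htp f g -> fmap F f = fmap F g.
Proof.
move=> hF [T [a [b [[[QT WT] RT] e]]]].
have [S [i [j [p [q hb]]]]] := exact_biproduct exE A T.
have tp : trivial_fibration W R p.
  by exists T, j; split; [exact: (biproduct_confl exE (biproduct_sym hb))|].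
case: hb => pi qj pj qi _.
have Fp := hF _ _ _ (tfib_we tp).
have Fij : fmap F (i + j \c a) = fmap F i.
  have [p' [pp pp']] := Fp.
  rewrite -[LHS]comp_idl -[RHS]comp_idl -pp -!compA -!fmap_comp.
  by rewrite comp_addr pi compA pj comp0m addr0.
have -> : f = (g \c p + b \c q) \c (i + j \c a).
  rewrite comp_addr !comp_addl -!compA (compA p j) (compA q j) pi qi pj qj.
  by rewrite comp_idr comp_idl comp0m !compm0 addr0 add0r -e addrC subrK.
have {2}-> : g = (g \c p + b \c q) \c i.
  by rewrite comp_addl -!compA pi qi comp_idr compm0 addr0.
by rewrite !fmap_comp Fij.
Qed.

(* S, I and pi present the quotient by htp of the full subcategory of bifibrant
   objects, up to replacing objects of E by copies of them. *)
Variables (S : category) (I : S -> E)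
  (pi : forall A B : S, hom (I A) (I B) -> hom A B).
Hypotheses (pi_id : forall A : S, pi (idm (I A)) = idm A)
  (pi_comp : forall (A B D : S) (g : hom (I B) (I D)) (f : hom (I A) (I B)),
    pi (g \c f) = pi g \c pi f)
  (pi_surj : forall (A B : S) (u : hom A B), exists f, pi f = u)
  (pi_eq : forall (A B : S) (f g : hom (I A) (I B)), pi f = pi g <-> htp f g)
  (I_Q : forall A : S, Q (I A)) (I_R : forall A : S, R (I A))
  (I_fibrant : forall M, Q M ->
    exists (A : S) (j : hom M (I A)), trivial_cofibration Q W j).

(* The zigzag M <- QM -> RQM. *)
Record replacement M := Replacement {
  cof : E;
  cof_map : hom cof M;
  bif : S;
  bif_map : hom cof (I bif);
  cofP : Q cof;
  cof_mapP : trivial_fibration W R cof_map;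
  bif_mapP : trivial_cofibration Q W bif_map
}.

Lemma replacement_exists M : exists r : replacement M, True.
Proof.
have [_ _ [_ /(_ M) [[K [P [k [q [c hK QP]]]]] _]]] := hov.
have [A [j tj]] := I_fibrant QP.
have tq : trivial_fibration W R q by exists K, k.
by exists (Replacement QP tq tj).
Qed.

Definition repl M := projT1 (cid (replacement_exists M)).
Definition Lob M := bif (repl M).
Notation Qo M := (cof (repl M)).
Notation qm M := (cof_map (repl M)).
Notation jm M := (bif_map (repl M)).

(** Strictly commuting lifts always exist; commutation up to homotopy already determines [f2] up to
    homotopy and is the form in which [theta_natural] supplies one. *)
Definition lifts M N (f : hom M N) (f2 : hom (I (Lob M)) (I (Lob N))) : Prop :=
  exists f1, htp (qm N \c f1) (f \c qm M) /\ htp (f2 \c jm M) (jm N \c f1).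

Lemma strict_lift M N (f : hom M N) : exists f1 f2,
  qm N \c f1 = f \c qm M /\ f2 \c jm M = jm N \c f1.
Proof.
have [f1 h1] := tfib_lift (f \c qm M) (cof_mapP (repl N)) (cofP (repl M)).
have [f2 h2] := tcof_extend (jm N \c f1) (bif_mapP (repl M)) (I_R (Lob N)).
by exists f1, f2.
Qed.

Lemma lifts_strict M N (f : hom M N) f1 f2 :
  qm N \c f1 = f \c qm M -> f2 \c jm M = jm N \c f1 -> lifts f f2.
Proof. by move=> h1 h2; exists f1; rewrite h1 h2; split; exact: htp_refl. Qed.

Lemma lifts_exists M N (f : hom M N) : exists f2, lifts f f2.
Proof.
by have [f1 [f2 [h1 h2]]] := strict_lift f; exists f2; exact: lifts_strict h1 h2.
Qed.

Lemma lifts_unique M N (f : hom M N) f2 f2' :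
  lifts f f2 -> lifts f f2' -> htp f2 f2'.
Proof.
move=> [f1 [h1 h2]] [f1' [h1' h2']].
apply: (htp_cancel_tcof (bif_mapP (repl M)) (I_R _)).
apply: (htp_trans h2); apply: htp_trans (htp_sym h2'); apply: htp_compl.
apply: (htp_cancel_tfib (cof_mapP (repl N)) (cofP (repl M))).
exact: htp_trans h1 (htp_sym h1').
Qed.

Definition Lmap M N (f : hom M N) : hom (Lob M) (Lob N) :=
  pi (projT1 (cid (lifts_exists f))).

Lemma LmapE M N (f : hom M N) f2 : lifts f f2 -> Lmap f = pi f2.
Proof. by move=> h; apply/pi_eq/lifts_unique; [exact: projT2 (cid _)|exact: h]. Qed.

Lemma Lmap_id M : Lmap (idm M) = idm (Lob M).
Proof.
rewrite -pi_id; apply/LmapE/(lifts_strict (f1 := idm _)).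
  by rewrite comp_idl comp_idr.
by rewrite comp_idl comp_idr.
Qed.

Lemma Lmap_comp M N D (g : hom N D) (f : hom M N) : Lmap (g \c f) = Lmap g \c Lmap f.
Proof.
have [f1 [f2 [hf1 hf2]]] := strict_lift f.
have [g1 [g2 [hg1 hg2]]] := strict_lift g.
rewrite (LmapE (lifts_strict hf1 hf2)) (LmapE (lifts_strict hg1 hg2)) -pi_comp.
apply/LmapE/(lifts_strict (f1 := g1 \c f1)).
  by rewrite compA hg1 -compA hf1 compA.
by rewrite -compA hf2 (compA g2) hg2 compA.
Qed.

Definition Lfun : functor E S := @Functor E S Lob Lmap Lmap_id Lmap_comp.

Lemma htp_iso (A B : S) (f : hom (I A) (I B)) (g : hom (I B) (I A)) :
  htp (g \c f) (idm _) -> htp (f \c g) (idm _) -> is_iso (pi f).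
Proof.
move=> /pi_eq h1 /pi_eq h2; exists (pi g).
by rewrite -!pi_comp h1 h2 !pi_id.
Qed.

(** Lifting [qm N] through [f] and then through [qm M] gives a map of cofibrant replacements,
    inverse to [f1] up to homotopy by cancellation of trivial fibrations. *)
Lemma Lmap_tfib M N (f : hom M N) : trivial_fibration W R f -> is_iso (Lmap f).
Proof.
move=> tf; have [f1 [f2 [hf1 hf2]]] := strict_lift f.
have [g0 hg0] := tfib_lift (qm N) tf (cofP (repl N)).
have [g1 hg1] := tfib_lift g0 (cof_mapP (repl M)) (cofP (repl N)).
have [g2 hg2] := tcof_extend (jm M \c g1) (bif_mapP (repl N)) (I_R (Lob M)).
rewrite (LmapE (lifts_strict hf1 hf2)); apply: (htp_iso (g := g2)).
  apply: (htp_cancel_tcof (bif_mapP (repl M)) (I_R _)).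
  rewrite -compA hf2 compA hg2 -compA comp_idl -{2}[jm M]comp_idr.
  apply: htp_compl; apply: (htp_cancel_tfib (cof_mapP (repl M)) (cofP (repl M))).
  apply: (htp_cancel_tfib tf (cofP (repl M))).
  rewrite comp_idr (compA (qm M)) hg1 compA hg0 hf1; exact: htp_refl.
apply: (htp_cancel_tcof (bif_mapP (repl N)) (I_R _)).
rewrite -compA hg2 compA hf2 -compA comp_idl -{2}[jm N]comp_idr.
apply: htp_compl; apply: (htp_cancel_tfib (cof_mapP (repl N)) (cofP (repl N))).
rewrite comp_idr compA hf1 -compA hg1 hg0; exact: htp_refl.
Qed.

(* The pullback P of the cofibrant replacement of N along f : M -> N is again a
   cofibrant replacement of M, because Q is closed under kernels of deflations. *)
Lemma Lmap_tcof M N (f : hom M N) : trivial_cofibration Q W f -> is_iso (Lmap f).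
Proof.
move=> [D [d [cf hD]]].
have [K [k [ck hK]]] := cof_mapP (repl N).
have [P [u [x [v [cu cx _ e]]]]] := comp_epi exE ck cf.
have tv : trivial_fibration W R v by exists K, x.
have tu : trivial_cofibration Q W u by exists D, (d \c qm N).
have QP : Q P := kerQ cu (cofP (repl N)) hD.1.
have [s hs] := tfib_lift (qm M) tv (cofP (repl M)).
have [s' hs'] := tfib_lift v (cof_mapP (repl M)) QP.
have ss' : htp (s \c s') (idm P).
  apply: (htp_cancel_tfib tv QP).
  rewrite compA hs hs' comp_idr; exact: htp_refl.
have s's : htp (s' \c s) (idm _).
  apply: (htp_cancel_tfib (cof_mapP (repl M)) (cofP (repl M))).
  rewrite compA hs' hs comp_idr; exact: htp_refl.
have hf1 : qm N \c (u \c s) = f \c qm M by rewrite compA e -compA hs.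
have [f2 hf2] := tcof_extend (jm N \c (u \c s)) (bif_mapP (repl M)) (I_R (Lob N)).
have [w hw] := tcof_extend (jm M \c s') tu (I_R (Lob M)).
have [g2 hg2] := tcof_extend w (bif_mapP (repl N)) (I_R (Lob M)).
rewrite (LmapE (lifts_strict hf1 hf2)); apply: (htp_iso (g := g2)).
  apply: (htp_cancel_tcof (bif_mapP (repl M)) (I_R _)).
  rewrite -compA hf2 !compA hg2 hw -compA comp_idl -{2}[jm M]comp_idr.
  exact: htp_compl.
apply: (htp_cancel_tcof (bif_mapP (repl N)) (I_R _)).
apply: (htp_cancel_tcof tu (I_R _)).
rewrite comp_idl -!compA (compA g2) hg2 hw (compA f2) hf2 -!compA.
apply: htp_compl; rewrite -{2}[u]comp_idr; exact: htp_compl.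
Qed.

Lemma Lfun_inverts : inverts Lfun (@weak_equivalence E Q W R).
Proof.
move=> A B f [T [i [p [ti tp ->]]]]; rewrite fmap_comp.
by apply: iso_comp; [exact: Lmap_tcof | exact: Lmap_tfib].
Qed.

Section Factorization.
Variables (D : category) (F : functor E D).
Hypothesis hF : inverts F (@weak_equivalence E Q W R).

Definition Gmap (A B : S) (u : hom A B) : hom (F (I A)) (F (I B)) :=
  fmap F (projT1 (cid (pi_surj u))).

Lemma Gmap_pi (A B : S) (f : hom (I A) (I B)) : Gmap (pi f) = fmap F f.
Proof. by rewrite /Gmap; case: (cid _) => g /= /pi_eq; exact: inverts_htp. Qed.

Lemma Gmap_id (A : S) : Gmap (idm A) = idm (F (I A)).
Proof. by rewrite -pi_id Gmap_pi fmap_id. Qed.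

Lemma Gmap_comp (A B T : S) (v : hom B T) (u : hom A B) : Gmap (v \c u) = Gmap v \c Gmap u.
Proof.
have [f <-] := pi_surj u; have [g <-] := pi_surj v.
by rewrite -pi_comp !Gmap_pi fmap_comp.
Qed.

Definition Gfun : functor S D := @Functor S D (fun A : S => F (I A)) Gmap Gmap_id Gmap_comp.

(** F inverts both legs of the zigzag, so the components are F(q) F(j)^-1. *)
Lemma Gfun_factors : nat_iso (compF Gfun Lfun) F.
Proof.
have Fj M : is_iso (fmap F (jm M)) by apply/hF/tcof_we; exact: bif_mapP.
have Fq M : is_iso (fmap F (qm M)) by apply/hF/tfib_we; exact: cof_mapP.
pose ji M := projT1 (cid (Fj M)).
have jiP M : ji M \c fmap F (jm M) = idm _ /\ fmap F (jm M) \c ji M = idm _.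
  exact: projT2 (cid (Fj M)).
exists (fun M => fmap F (qm M) \c ji M) => [M N f|M] /=.
  have [f1 [f2 [hf1 hf2]]] := strict_lift f.
  rewrite (LmapE (lifts_strict hf1 hf2)) Gmap_pi compA -fmap_comp -hf1 fmap_comp.
  rewrite -!compA; congr (_ \c _).
  by apply: (iso_square (jiP N).1 (jiP M).2); rewrite -!fmap_comp hf2.
apply: iso_comp (Fq M); exists (fmap F (jm M)).
by have [? ?] := jiP M.
Qed.

End Factorization.

(** * Natural transformations between functors on the localization *)

Section Uniqueness.

(** On a bifibrant object the zigzag can be inverted: [q] has a section s, [q] extends along [j],
    and j s is a homotopy equivalence. *)
Lemma theta_exists (A : S) : exists (t : hom (I A) (I (Lob (I A))))
    (t' : hom (I (Lob (I A))) (I A)),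
  [/\ htp (t \c qm (I A)) (jm (I A)), t' \c jm (I A) = qm (I A),
      t' \c t = idm _ & htp (t \c t') (idm _)].
Proof.
have [s hs] := tfib_lift (idm (I A)) (cof_mapP (repl (I A))) (I_Q A).
have [t' ht'] := tcof_extend (qm (I A)) (bif_mapP (repl (I A))) (I_R A).
have tq : htp (jm (I A) \c s \c qm (I A)) (jm (I A)).
  rewrite -compA -{2}[jm _]comp_idr; apply: htp_compl.
  apply: (htp_cancel_tfib (cof_mapP (repl (I A))) (cofP (repl (I A)))).
  rewrite compA hs comp_idl comp_idr; exact: htp_refl.
exists (jm (I A) \c s), t'; split=> //; first by rewrite compA ht' hs.
apply: (htp_cancel_tcof (bif_mapP (repl (I A))) (I_R _)).
by rewrite -compA ht' comp_idl.
Qed.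

Definition theta (A : S) := pi (projT1 (cid (theta_exists A))).

Lemma thetaP (A : S) : exists t t',
  [/\ theta A = pi t, htp (t \c qm (I A)) (jm (I A)), t' \c jm (I A) = qm (I A),
      t' \c t = idm _ & htp (t \c t') (idm _)].
Proof.
rewrite /theta; case: (cid _) => t [t' [h1 h2 h3 h4]] /=.
by exists t, t'.
Qed.

Lemma theta_iso (A : S) : is_iso (theta A).
Proof.
have [t [t' [-> _ _ h3 h4]]] := thetaP A.
by apply: (htp_iso _ h4); rewrite h3; exact: htp_refl.
Qed.

Lemma theta_natural (A B : S) (f : hom (I A) (I B)) :
  Lmap f \c theta A = theta B \c pi f.
Proof.
have [t [t' [-> h1 h2 h3 h4]]] := thetaP A.
have [r [r' [-> k1 k2 k3 k4]]] := thetaP B.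
have [f1 [_ [hf1 _]]] := strict_lift f.
rewrite (LmapE (f2 := r \c f \c t')).
  by rewrite -!pi_comp -!compA h3 comp_idr.
exists f1; split; first by rewrite hf1; exact: htp_refl.
rewrite -!compA h2 -hf1 compA; exact: htp_compr.
Qed.

(** Says that [theta] at [Lob M] is L(j) L(q)^-1; this is what makes the transformation built from
    [theta] restrict to the given one. *)
Lemma theta_L M : theta (Lob M) \c Lmap (qm M) = Lmap (jm M).
Proof.
have [t [t' [-> h1 h2 h3 h4]]] := thetaP (Lob M).
have [f1 [f2 [hf1 hf2]]] := strict_lift (qm M).
have [g1 [g2 [hg1 hg2]]] := strict_lift (jm M).
rewrite (LmapE (lifts_strict hf1 hf2)) (LmapE (lifts_strict hg1 hg2)) -pi_comp.
apply/pi_eq; apply: (htp_cancel_tcof (bif_mapP (repl (Qo M))) (I_R _)).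
rewrite -compA hf2 hg2; apply: htp_trans (htp_compr g1 h1).
rewrite -(compA t (qm _)) hg1; do 2 apply: htp_compl.
apply: (htp_cancel_tfib (cof_mapP (repl M)) (cofP (repl (Qo M)))).
rewrite hf1; exact: htp_refl.
Qed.

(** Naturality along [theta] forces b A = G'(theta)^-1 a(I A) G(theta), which proves uniqueness and
    serves as the definition. *)
Lemma Lfun_transformation (D : category) (G G' : functor S D)
    (a : forall M, hom (compF G Lfun M) (compF G' Lfun M)) : natural a ->
  exists b : forall A : S, hom (G A) (G' A),
    [/\ natural b, forall M, b (Lfun M) = a M &
      forall b' : forall A : S, hom (G A) (G' A), natural b' ->
        (forall M, b' (Lfun M) = a M) -> forall A : S, b' A = b A].
Proof.
move=> na.
have Gt (A : S) := fmap_iso G (theta_iso A).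
have Gt' (A : S) := fmap_iso G' (theta_iso A).
pose ti (A : S) := projT1 (cid (Gt' A)).
have tiP (A : S) : ti A \c fmap G' (theta A) = idm _ /\ fmap G' (theta A) \c ti A = idm _.
  exact: projT2 (cid (Gt' A)).
have [b bP] : exists b : forall A : S, hom (G A) (G' A),
    forall A : S, fmap G' (theta A) \c b A = a (I A) \c fmap G (theta A).
  exists (fun A : S => ti A \c (a (I A) \c fmap G (theta A))) => A.
  by rewrite compA (tiP A).2 comp_idl.
have mono_t (A : S) (T : D) (x y : hom T (G' A)) :
    fmap G' (theta A) \c x = fmap G' (theta A) \c y -> x = y.
  by move=> e; rewrite -(comp_idl x) -(comp_idl y) -(tiP A).1 -!compA e.
exists b; split.
- move=> A B u; have [f <-] := pi_surj u; apply: mono_t.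
  rewrite !compA bP -fmap_comp -theta_natural fmap_comp -!compA bP.
  have /= e := na _ _ f.
  by rewrite compA e -compA -!fmap_comp theta_natural.
- move=> M; apply: mono_t; rewrite bP.
  have Gq : is_iso (fmap G (Lmap (qm M))).
    by apply/fmap_iso/Lmap_tfib; exact: cof_mapP.
  apply: (iso_cancel Gq); rewrite -!compA -fmap_comp theta_L.
  have /= <- := na _ _ (jm M); have /= <- := na _ _ (qm M).
  by rewrite compA -fmap_comp theta_L.
- by move=> b' nb' hb' A; apply: mono_t; rewrite bP -hb' nb'.
Qed.

End Uniqueness.

Lemma Lfun_localization : is_localization (@weak_equivalence E Q W R) Lfun.
Proof.
split; first exact: Lfun_inverts.
- by move=> D F hF; exists (Gfun hF); exact: Gfun_factors.
- by move=> D G G' a; exact: Lfun_transformation.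
Qed.

End HoveyLocalization.

(** * Uniqueness of localizations up to equivalence *)

Section LocalizationUnique.

Lemma nat_isoP (C D : category) (F G : functor C D) : nat_iso F G ->
  exists (a : forall A, hom (F A) (G A)) (a' : forall A, hom (G A) (F A)),
    [/\ natural a, natural a', forall A, a' A \c a A = idm _ &
        forall A, a A \c a' A = idm _].
Proof.
move=> [a na ia]; pose a' A := projT1 (cid (ia A)).
have a'P A : a' A \c a A = idm _ /\ a A \c a' A = idm _ by exact: projT2 (cid (ia A)).
exists a, a'; split=> // A => [B f||]; [|by case: (a'P A)|by case: (a'P A)].
exact: (iso_square (a'P B).1 (a'P A).2 (esym (na _ _ f))).
Qed.

(** Both directions extend along L; their composites extend identities, hence are identities by
    uniqueness of extensions. *)
Lemma localization_nat_iso (C H D : category) (W : morphism_class C)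
    (L : functor C H) (F G : functor H D) :
  is_localization W L -> nat_iso (compF F L) (compF G L) -> nat_iso F G.
Proof.
move=> [_ _ hL] /nat_isoP [a [a' [na na' aa aa']]].
have [b [nb hb _]] := hL _ _ _ a na.
have [b' [nb' hb' _]] := hL _ _ _ a' na'.
have uniq (K : functor H D) (x : forall B, hom (K B) (K B)) : natural x ->
    (forall A, x (L A) = idm _) -> forall B, x B = idm _.
  move=> nx hx B.
  have nid : natural (F := compF K L) (G := compF K L) (fun A => idm (K (L A))).
    by move=> A A' f /=; rewrite comp_idl comp_idr.
  have [y [_ _ hy]] := hL _ _ _ _ nid.
  rewrite (hy x nx hx); apply/esym/(hy (fun B => idm _)) => //.
  by move=> A A' f /=; rewrite comp_idl comp_idr.
exists b => // B; exists (b' B); split.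
  apply: (uniq F (fun B => b' B \c b B)) => [A A' f|A].
    by rewrite compA nb' -compA nb compA.
  by rewrite hb hb' aa.
apply: (uniq G (fun B => b B \c b' B)) => [A A' f|A].
  by rewrite compA nb -compA nb' compA.
by rewrite hb hb' aa'.
Qed.

Lemma nat_iso_comp (C H H' : category) (L : functor C H) (L' : functor C H')
    (G : functor H H') (G' : functor H' H) :
  nat_iso (compF G L) L' -> nat_iso (compF G' L') L ->
  nat_iso (compF (compF G' G) L) (compF (idF H) L).
Proof.
move=> [a na ia] [a' na' ia'].
exists (fun A => a' A \c fmap G' (a A)) => [A B f|A] /=; last first.
  by apply: iso_comp (ia' A); apply: fmap_iso; exact: ia.
have /= e := na A B f; have /= e' := na' A B f.
by rewrite compA e' -!compA -!fmap_comp e.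
Qed.

Lemma localization_unique (C H H' : category) (W : morphism_class C)
    (L : functor C H) (L' : functor C H') :
  is_localization W L -> is_localization W L' -> equivalent H H'.
Proof.
move=> hL hL'; have [iL eL _] := hL; have [iL' eL' _] := hL'.
have [G hG] := eL _ _ iL'; have [G' hG'] := eL' _ _ iL.
exists G, G'; split.
- exact: localization_nat_iso hL (nat_iso_comp hG hG').
- exact: localization_nat_iso hL' (nat_iso_comp hG' hG).
Qed.

End LocalizationUnique.

Theorem theorem4p8 (C : abelianCat) (X Y omega : set C) (m : nat)
  (hX : cotorsion_pair X (perp X))
  (hXher : hereditary_pair X (perp X))
  (hXcomp : complete_pair X (perp X))
  (hY : frobenius_pair Y omega)
  (hthick : thick (perp X))
  (hXY : X `<=` Y)
  (homega : X `&` perp X = omega)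
  (hcot : cotorsion_pair (hat omega m) (rperp 1 (hat omega m)))
  (hcomp : complete_pair (hat omega m) (rperp 1 (hat omega m)))
  (n : nat) (hmn : (m <= n)%N) :
  let Yn := hat Y n in
  let E := full_exact Yn in
  let Q := hat X m in
  let W := perp X `&` Yn in
  let R := rperp 1 (hat omega m) `&` Yn in
  let bifibrant := hat X m `&` rperp 1 (hat omega m) in
  let triv_bifibrant := hat omega m `&` rperp 1 (hat omega m) in
  let we := weak_equivalence (restr Yn Q) (restr Yn W) (restr Yn R) in
  [/\ is_exact_cat E /\ weakly_idempotent_complete E,
      Q `<=` Yn,
      hereditary_hovey_triple (restr Yn Q) (restr Yn W) (restr Yn R),
      Q `&` W `&` R = triv_bifibrant &
      exists hsim : is_congruence (@factor_rel C bifibrant triv_bifibrant),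
        (exists (H : category) (L : functor E H), is_localization we L) /\
        forall (H : category) (L : functor E H), is_localization we L ->
          equivalent H (quotient_cat hsim)].
Proof.
move=> Yn E Q W R bifibrant triv_bifibrant we.
have exE : is_exact_cat E by exact: (Yn_exact hX hXcomp hY hthick hXY homega).
have QYn : Q `<=` Yn by exact: (hatX_sub_hatY hX hY hXY homega hmn).
have hovE : hereditary_hovey_triple (restr Yn Q) (restr Yn W) (restr Yn R).
  exact: (hovey_QWR hX hXcomp hY hthick hXY homega).
have eZ : Q `&` W `&` R = triv_bifibrant.
  exact: (trivially_bifibrant hX hXcomp hY hthick hXY homega).
split=> //.
  split=> //; exact: (Yn_wic hX hXcomp hY hthick hXY homega).
have [hov _ _] := hovE.
(* Bifibrant objects are cut out of C in the statement; they lie in hat Y n because hat X m does. *)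
pose I (A : full_preadd bifibrant) : E := exist _ (sval A) (QYn _ (svalP A).1).
(* The relation of the statement factors through objects of C, [htp] through objects of E; they
   agree because every trivially bifibrant object lies in hat Y n. *)
have htpP (A B : full_preadd bifibrant) (f g : hom A B) :
    factor_rel triv_bifibrant f g <->
    htp (restr Yn Q) (restr Yn W) (restr Yn R) (f : hom (I A) (I B)) g.
  split=> -[T [a [b [hT e]]]].
    move: hT; rewrite -eZ => hT.
    by exists (exist _ T (QYn _ hT.1.1)), a, b.
  by exists (sval T), a, b; split=> //; rewrite -eZ.
have hsim : is_congruence (@factor_rel C bifibrant triv_bifibrant).
  split.
  - by move=> A B f; apply/htpP; exact: htp_refl exE hov _ _ _.
  - by move=> A B f g /htpP h; apply/htpP; exact: htp_sym h.
  - move=> A B f g h /htpP fg /htpP gh; apply/htpP.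
    exact: htp_trans exE hov _ _ _ _ _ fg gh.
  - move=> A B D f f' g g' /htpP ff /htpP gg; apply/htpP.
    have h1 := htp_compl (g : hom (I B) (I D)) ff.
    have h2 := htp_compr (f' : hom (I A) (I B)) gg.
    exact: htp_trans exE hov _ _ _ _ _ h1 h2.
exists hsim.
have [L hL] : exists L : functor E (quotient_cat hsim), is_localization we L.
  have kerQ : epi_ker_closed (restr Yn Q).
    exact: (Q_epi_ker_closed hX hXcomp hthick homega).
  have pi_eq (A B : full_preadd bifibrant) (f g : hom (I A) (I B)) :
      quot_pi hsim f = quot_pi hsim g <->
      htp (restr Yn Q) (restr Yn W) (restr Yn R) f g.
    by rewrite quot_pi_eq; exact: htpP.
  have I_fibrant (M : E) : restr Yn Q M -> exists (A : quotient_cat hsim)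
      (j : hom M (I A)), trivial_cofibration (restr Yn Q) (restr Yn W) j.
    move=> QM; have [_ [_ /(_ M) [_ [B [N [j [p [c [RB YB] hN]]]]]]] _] := hov.
    (* A fibrant replacement of a cofibrant object stays cofibrant, as an extension of N by M. *)
    have QB : Q (sval B) := hovey_ext_Q exE hov c QM hN.1.
    by exists (exist _ (sval B) (conj QB RB)), j, N, p.
  have pi_id (A : full_preadd bifibrant) :
    quot_pi hsim (idm (I A) : hom A A) = idm (A : quotient_cat hsim) by [].
  have pi_comp (A B D : full_preadd bifibrant) (g : hom (I B) (I D))
      (f : hom (I A) (I B)) :
    quot_pi hsim (g \c f : hom A D) =
    (quot_pi hsim g : @hom (quotient_cat hsim) B D) \c quot_pi hsim f.
    exact: (esym (quot_comp_pi hsim (g : hom B D) (f : hom A B))).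
  have pi_surj (A B : full_preadd bifibrant) (u : @hom (quotient_cat hsim) A B) :
    exists f : hom (I A) (I B), quot_pi hsim f = u.
    by have [f ->] := quot_piP (u : quot_hom hsim A B); exists f.
  have I_Q (A : full_preadd bifibrant) : restr Yn Q (I A) by have [] := svalP A.
  have I_R (A : full_preadd bifibrant) : restr Yn R (I A).
    by have [QA RA] := svalP A; split=> //; exact: svalP (I A).
  eexists.
  exact: (@Lfun_localization E _ _ _ exE hov kerQ (quotient_cat hsim) I
    (fun A B f => quot_pi hsim f) pi_id pi_comp pi_surj pi_eq I_Q I_R I_fibrant).
split; first by exists (quotient_cat hsim), L.
by move=> H L' hL'; exact: localization_unique hL' hL.
Qed.
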